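(* There exists a boundedly acyclic group $\Gamma$ with a normal subgroup $H$ such that $\Gamma/H$ is boundedly acyclic, but $\operatorname{H}^n_b(H;\mathbb{R})$ has dimension equal to the cardinality of the continuum for every $n \geq 2$.
   Context: $\operatorname{H}^*_b(\cdot;\mathbb{R})$ denotes bounded cohomology of groups with trivial real coefficients. A group $G$ is boundedly acyclic if $\operatorname{H}^n_b(G;\mathbb{R}) \cong 0$ for all $n\geq 1$. *)

(* Defs.v *)
From HB Require Import structures.
From mathcomp Require Import all_boot all_order all_algebra.
From Stdlib Require Import Rdefinitions.
From mathcomp Require Import Rstruct.
Set Implicit Arguments. Unset Strict Implicit. Unset Printing Implicit Defensive.
Import Order.TTheory GRing.Theory Num.Theory.
Local Open Scope ring_scope.

Record group := Group {
  gcar :> Type;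
  gmul : gcar -> gcar -> gcar;
  ginv : gcar -> gcar;
  gone : gcar;
  gmulA : forall x y z, gmul x (gmul y z) = gmul (gmul x y) z;
  gmul1 : forall x, gmul gone x = x;
  gmulV : forall x, gmul (ginv x) x = gone }.
Arguments gmul {g}. Arguments ginv {g}. Arguments gone {g}.

Definition is_hom (G K : group) (f : G -> K) : Prop :=
  forall x y, f (gmul x y) = gmul (f x) (f y).

(* Homogeneous cochains of degree n with trivial real coefficients:
   functions G^{n+1} -> R. *)
Definition cochain (G : group) (n : nat) := ('I_n.+1 -> G) -> R.

Definition bounded_cochain (G : group) n (f : cochain G n) : Prop :=
  exists M : R, forall x, `|f x| <= M.

Definition invariant_cochain (G : group) n (f : cochain G n) : Prop :=
  forall (g : G) x, f (fun j => gmul g (x j)) = f x.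

Definition bcochain (G : group) n (f : cochain G n) : Prop :=
  bounded_cochain f /\ invariant_cochain f.

Definition delta (G : group) n (f : cochain G n) : cochain G n.+1 :=
  fun x => \sum_(i < n.+2) (-1) ^+ i * f (fun j => x (lift i j)).

Definition bcocycle (G : group) n (f : cochain G n) : Prop :=
  bcochain f /\ forall x, delta f x = 0.

Definition bcoboundary (G : group) n (z : cochain G n.+1) : Prop :=
  exists g : cochain G n, bcochain g /\ forall x, z x = delta g x.

Definition boundedly_acyclic (G : group) : Prop :=
  forall n (z : cochain G n.+1), bcocycle z -> bcoboundary z.

Definition lincomb (G : group) n (b : R -> cochain G n) (rs : seq R)
  (c : R -> R) : cochain G n :=
  fun x => \sum_(r <- rs) c r * b r x.

(* H^{n+1}_b(G;R) has a basis indexed by R, i.e. its dimension is the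
   cardinality of the continuum. *)
Definition Hb_dim_continuum (G : group) n : Prop :=
  exists b : R -> cochain G n.+1,
    (forall r, bcocycle (b r)) /\
    (forall (rs : seq R) (c : R -> R), uniq rs ->
        bcoboundary (lincomb b rs c) -> forall r, r \in rs -> c r = 0) /\
    (forall z : cochain G n.+1, bcocycle z ->
        exists (rs : seq R) (c : R -> R),
          bcoboundary (fun x => z x - lincomb b rs c x)).

(* Main.v *)
(** Let lamp C be the wreath product of a countable group C by the finitary symmetric group
    of nat. It is boundedly acyclic: multiplying the arguments of a bounded cocycle on the right
    by independent random elements changes it by a bounded coboundary, and by invariance the
    cocycle cannot tell one position from the many positions filled with random letters, so that
    a law of large numbers makes the averages asymptotically constant. This applies to
    Gamma = lamp B and to its quotient lamp 1 by H, the direct sum of copies of B.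

    Nontrivial classes come from a suspension. Let c be a nontrivial bounded cocycle on C, and
    let two copies of lamp C sharing the copy of C at position 0 act on a tree. Summing over the
    path from g_0 to g_1, with alternating signs, the values of c on the projections of
    g_1, ..., g_n gives a cocycle one degree higher, as in a Mayer-Vietoris sequence. It is
    bounded, since the sum telescopes except where the path meets the branch points of the other
    arguments, and nontrivial, since by bounded acyclicity of both copies a primitive would
    restrict to a primitive of c. Starting from the quasimorphism class of a free product of
    involutions, one gets countable groups with nontrivial classes in all degrees at least 2; B is
    their direct sum. For c on B, the cocycles sum_i t^i c(x_i) with 0 <= t <= 1/2 on H are
    independent by a Vandermonde argument, and H has only continuum many cochains since it is
    countable. *)
Require Import Defs.
From HB Require Import structures.
From mathcomp Require Import all_boot all_order all_algebra perm.
From Stdlib Require Import Rdefinitions.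
From mathcomp Require Import boolp classical_sets functions cardinality filter reals.
From mathcomp Require Import Rstruct.
From mathcomp Require Import zify ring lra.
Set Implicit Arguments. Unset Strict Implicit. Unset Printing Implicit Defensive.
Import Order.TTheory GRing.Theory Num.Theory.
Local Open Scope ring_scope.
Bind Scope ring_scope with R.
Delimit Scope nat_scope with N.

(** * Group identities, bounded cochains on sequences, and the prism homotopy *)

Section Groups.
Variable G : group.
Implicit Types x y z : G.

Lemma gmulKV x y : gmul (ginv x) (gmul x y) = y.
Proof. by rewrite gmulA gmulV gmul1. Qed.

Lemma gmulI x y z : gmul x y = gmul x z -> y = z.
Proof. by move=> e; rewrite -[y](gmulKV x) e gmulKV. Qed.

Lemma gmulVr x : gmul x (ginv x) = gone.
Proof. by rewrite -[LHS](gmulKV (ginv x)) (gmulKV x (ginv x)) gmulV. Qed.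

Lemma gmulr1 x : gmul x gone = x.
Proof. by rewrite -(gmulV x) gmulA gmulVr gmul1. Qed.

Lemma gmulKr x y : gmul x (gmul (ginv x) y) = y.
Proof. by rewrite gmulA gmulVr gmul1. Qed.

Lemma ginvK x : ginv (ginv x) = x.
Proof. by apply: (@gmulI (ginv x)); rewrite gmulVr gmulV. Qed.

Lemma ginv_uniq x y : gmul x y = gone -> y = ginv x.
Proof. by move=> e; apply: (@gmulI x); rewrite e gmulVr. Qed.

Lemma ginvM x y : ginv (gmul x y) = gmul (ginv y) (ginv x).
Proof. by apply/esym/ginv_uniq; rewrite -gmulA gmulKr gmulVr. Qed.

Lemma ginv1 : ginv (gone : G) = gone.
Proof. by apply/esym/ginv_uniq; rewrite gmul1. Qed.

End Groups.

Lemma hom1 (G K : group) (f : G -> K) : is_hom f -> f gone = gone.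
Proof. by move=> fM; apply: (@gmulI _ (f gone)); rewrite -fM gmul1 gmulr1. Qed.

Lemma homV (G K : group) (f : G -> K) x : is_hom f -> f (ginv x) = ginv (f x).
Proof. by move=> fM; apply: ginv_uniq; rewrite -fM gmulVr hom1. Qed.

(* Cochains are handled as functions on sequences, the degree being the size minus one:
   the simplicial coboundary then has a one-line recursion. *)
Fixpoint ds (T : Type) (f : seq T -> R) (s : seq T) : R :=
  if s is x :: s' then f s' - ds (fun t => f (x :: t)) s' else 0.

Section Ds.
Variable T : Type.
Implicit Types (f g : seq T -> R) (s : seq T).

Lemma eq_ds n f g s : size s = n.+1 -> (forall t, size t = n -> f t = g t) -> ds f s = ds g s.
Proof.
elim: n f g s => [|n IHn] f g [|x s] //= [sz] e; first by case: s sz => //= _; rewrite e.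
by rewrite e //; congr (_ - _); apply: IHn => // t st; apply: e => /=; rewrite st.
Qed.

Lemma ext_ds f g s : f =1 g -> ds f s = ds g s.
Proof. by case: s => [//|x s] e; apply: (@eq_ds (size s)) => // t _; exact: e. Qed.

Lemma dsD f g s : ds (fun t => f t + g t) s = ds f s + ds g s.
Proof. elim: s f g => [|x s IHs] f g /=; [lra | rewrite IHs; lra]. Qed.

Lemma dsZ a f s : ds (fun t => a * f t) s = a * ds f s.
Proof. elim: s f => [|x s IHs] f /=; [lra | rewrite IHs; lra]. Qed.

Lemma dsN f s : ds (fun t => - f t) s = - ds f s.
Proof. elim: s f => [|x s IHs] f /=; [lra | rewrite IHs; lra]. Qed.

Lemma dsB f g s : ds (fun t => f t - g t) s = ds f s - ds g s.
Proof. by rewrite dsD dsN. Qed.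

Lemma ds0 s : ds (fun _ : seq T => 0) s = 0.
Proof. elim: s => [|x s IHs] //=; rewrite IHs; lra. Qed.

Lemma ds_sum (I : Type) (r : seq I) (f : I -> seq T -> R) s :
  ds (fun t => \sum_(i <- r) f i t) s = \sum_(i <- r) ds (f i) s.
Proof.
elim: r => [|i r IHr]; first by rewrite big_nil -[RHS](ds0 s); apply: ext_ds => t; rewrite big_nil.
by rewrite big_cons -IHr -dsD; apply: ext_ds => t; rewrite big_cons.
Qed.

Lemma ds_ds f s : ds (ds f) s = 0.
Proof.
elim: s f => [|x s IHs] f //=.
by rewrite [X in _ - X = _](dsB f (ds (fun u => f (x :: u)))) IHs; lra.
Qed.

Lemma ds_cst a s : ds (fun _ : seq T => a) s = if odd (size s) then a else 0.
Proof. elim: s => [|x s IHs] //=; rewrite IHs; case: (odd _) => /=; lra. Qed.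

Lemma ds_bound n (M : R) f s : (forall t, size t = n -> `|f t| <= M) -> size s = n.+1 ->
  `|ds f s| <= n.+1%:R * M.
Proof.
elim: n f s => [|n IHn] f [|x s] //= fM [sz].
  by case: s sz => //= _; rewrite subr0 mul1r fM.
apply: le_trans (ler_normB _ _) _; rewrite -natr1 mulrDl mul1r addrC lerD ?fM //.
by apply: IHn => // t st; apply: fM; rewrite /= st.
Qed.

End Ds.

Lemma ds_map (T U : Type) (h : T -> U) f s : ds f (map h s) = ds (fun t => f (map h t)) s.
Proof. elim: s f => [|x s IHs] f //=; by rewrite IHs. Qed.

Lemma dsE (T : Type) (f : seq T -> R) s :
  ds f s = \sum_(i < size s) (-1) ^+ i * f (take i s ++ drop i.+1 s).
Proof.
elim: s f => [|x s IHs] f /=; first by rewrite big_ord0.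
rewrite big_ord_recl /= expr0 mul1r drop0 IHs -sumrN; congr (_ + _).
by apply: eq_bigr => i _; rewrite /bump /= add1n exprS mulN1r mulNr.
Qed.

(** For pairs [(u_i, v_i)] this is the alternating sum over i of [f (u_0, ..., u_i, v_i, ..., v_n)],
    the chain homotopy between the two projections from pairs. *)
Fixpoint prism (T : Type) (f : seq T -> R) (s : seq (T * T)) : R :=
  if s is p :: s' then
    f (p.1 :: p.2 :: map snd s') - prism (fun t => f (p.1 :: t)) s'
  else 0.

Lemma eq_prism (T : Type) n (f g : seq T -> R) s : size s = n ->
  (forall t, size t = n.+1 -> f t = g t) -> prism f s = prism g s.
Proof.
elim: n f g s => [|n IHn] f g [|x s] //= [sz] e.
by rewrite e /= ?size_map ?sz //; congr (_ - _); apply: IHn => // t st; apply: e => /=; rewrite st.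
Qed.

Lemma prismB (T : Type) (f g : seq T -> R) s :
  prism (fun t => f t - g t) s = prism f s - prism g s.
Proof. elim: s f g => [|x s IHs] f g /=; [lra | rewrite IHs; lra]. Qed.

Lemma prism0 (T : Type) s : prism (fun _ : seq T => 0) s = 0.
Proof. elim: s => [|x s IHs] //=; rewrite IHs; lra. Qed.

Lemma prism_homotopy (T : Type) (f : seq T -> R) s :
  ds (prism f) s + prism (ds f) s = f (map snd s) - f (map fst s).
Proof.
elim: s f => [|[u v] s IHs] f /=; first lra.
rewrite [ds (fun t => _) s](dsB (fun t => f (u :: v :: map snd t)) (prism (fun t => f (u :: t)))).
rewrite [prism (fun t => _ - _) s](prismB f (ds (fun t => f (u :: t)))).
have := IHs (fun t => f (u :: t)); rewrite -(ds_map snd (fun t => f (u :: v :: t))) /=; lra.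
Qed.

Lemma prism_bound (T : Type) n (M : R) (f : seq T -> R) s : (forall t, size t = n.+1 -> `|f t| <= M) ->
  size s = n -> `|prism f s| <= n%:R * M.
Proof.
elim: n f s => [|n IHn] f [|p s] //= fM; first by rewrite normr0 mul0r.
move=> [sz]; apply: le_trans (ler_normB _ _) _; rewrite -natr1 mulrDl mul1r addrC lerD ?fM //=.
  by apply: IHn => // t st; apply: fM; rewrite /= st.
by rewrite size_map sz.
Qed.

Lemma prism_map (T U : Type) (h : T -> U) f s :
  prism f (map (fun p => (h p.1, h p.2)) s) = prism (fun t => f (map h t)) s.
Proof. by elim: s f => [|p s IHs] f //=; rewrite IHs -!map_comp. Qed.

(** The index is the length of the arguments, one more than the degree, and values at other lengths
    are unconstrained. In [bcobd] it is the length for the primitive. *)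
Definition bcoch (G : group) n (f : seq G -> R) : Prop :=
  (exists M : R, forall s, size s = n -> `|f s| <= M) /\
  (forall g s, size s = n -> f (map (gmul g) s) = f s).

Definition bcocyc (G : group) n (f : seq G -> R) : Prop :=
  bcoch n f /\ (forall s, size s = n.+1 -> ds f s = 0).

Definition bcobd (G : group) n (f : seq G -> R) : Prop :=
  exists2 h, bcoch n h & forall s, size s = n.+1 -> f s = ds h s.

Section Bridge.
Variable G : group.
Implicit Types (n : nat) (F : seq G -> R).

Definition toseq n (f : cochain G n) : seq G -> R := fun s => f (fun i => nth gone s i).
Definition ofseq n F : cochain G n := fun x => F (map x (enum 'I_n.+1)).

Lemma size_ordmap n (x : 'I_n -> G) : size (map x (enum 'I_n)) = n.
Proof. by rewrite size_map size_enum_ord. Qed.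

Lemma nth_ordmap n (x : 'I_n -> G) (i : 'I_n) : nth gone (map x (enum 'I_n)) i = x i.
Proof. by rewrite (nth_map i) ?size_enum_ord ?ltn_ord // nth_ord_enum. Qed.

Lemma ofseqK n F s : size s = n.+1 -> toseq (@ofseq n F) s = F s.
Proof.
move=> sz; congr F; apply: (@eq_from_nth _ gone); rewrite size_ordmap ?sz // => i lti.
by rewrite (nth_ordmap _ (Ordinal lti)).
Qed.

Lemma toseqK n (f : cochain G n) : ofseq (toseq f) = f.
Proof. by apply/funext => x; congr f; apply/funext => i; rewrite nth_ordmap. Qed.

Lemma nth_skip (s : seq G) (i j : nat) : (i < size s)%N ->
  nth gone (take i s ++ drop i.+1 s) j = nth gone s (bump i j).
Proof.
move=> lti; rewrite nth_cat size_take lti /bump; case: ltnP => ltj /=.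
  by rewrite nth_take.
by rewrite nth_drop; congr nth; lia.
Qed.

Lemma toseq_delta n (f : cochain G n) s : size s = n.+2 -> toseq (delta f) s = ds (toseq f) s.
Proof.
move=> sz; rewrite dsE sz; apply: eq_bigr => i _; congr (_ * f _); apply/funext => j.
by rewrite nth_skip ?sz.
Qed.

Lemma bcochP n (f : cochain G n) : bcochain f <-> bcoch n.+1 (toseq f).
Proof.
split=> -[[M fM] finv]; split.
- by exists M => s _; exact: fM.
- move=> g s sz; rewrite -[RHS](finv g) /toseq; congr f; apply/funext => i.
  by rewrite (nth_map gone) ?sz.
- by exists M => x; rewrite -[f]toseqK; apply: fM; rewrite size_ordmap.
- move=> g x; rewrite -[f]toseqK /ofseq -[RHS](finv g) ?size_ordmap //.
  by rewrite -map_comp.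
Qed.

Lemma bcocycP n (f : cochain G n) : bcocycle f <-> bcocyc n.+1 (toseq f).
Proof.
split=> -[/bcochP fb fc]; split=> //.
  by move=> s sz; rewrite -toseq_delta // /toseq fc.
by move=> x; rewrite -[delta f]toseqK /ofseq toseq_delta ?fc ?size_ordmap.
Qed.

Lemma eq_bcoch n F F' : (forall s, size s = n -> F s = F' s) -> bcoch n F -> bcoch n F'.
Proof.
move=> e [[M FM] Finv]; split; first by exists M => s sz; rewrite -e // FM.
by move=> g s sz; rewrite -!e ?size_map // Finv.
Qed.

Lemma eq_bcobd n F F' : (forall s, size s = n.+1 -> F s = F' s) -> bcobd n F -> bcobd n F'.
Proof. by move=> e [h hb he]; exists h => // s sz; rewrite -e // he. Qed.

Lemma bcobdP n (f : cochain G n.+1) : bcoboundary f <-> bcobd n.+1 (toseq f).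
Proof.
split=> [[g [/bcochP gb ge]]|[h hb he]].
  by exists (toseq g) => // s sz; rewrite -toseq_delta // /toseq ge.
exists (ofseq h); split.
  by apply/bcochP; apply: eq_bcoch hb => s sz; rewrite ofseqK.
move=> x; rewrite -[f]toseqK -[delta _]toseqK /ofseq he ?size_ordmap // toseq_delta ?size_ordmap //.
by apply: (@eq_ds _ n.+1) => [|t st]; rewrite ?size_ordmap ?ofseqK.
Qed.

Lemma boundedly_acyclicP :
  boundedly_acyclic G <-> forall n F, bcocyc n.+2 F -> bcobd n.+1 F.
Proof.
split=> [ba n F [Fb Fc]|ba n z /bcocycP zc]; last by apply/bcobdP; exact: ba.
have e s : size s = n.+2 -> F s = toseq (@ofseq n.+1 F) s by move=> sz; rewrite ofseqK.
apply: (@eq_bcobd n.+1 (toseq (@ofseq n.+1 F))) => [s sz|]; first by rewrite ofseqK.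
apply/bcobdP/ba/bcocycP; split; first exact: eq_bcoch Fb.
by move=> s sz; rewrite -(Fc s) //; apply: (@eq_ds _ n.+2) => // t st; rewrite ofseqK.
Qed.

End Bridge.

Section Pullback.
Variables (G K : group) (j : G -> K).
Hypothesis jM : is_hom j.

Lemma map_hom g s : map j (map (gmul g) s) = map (gmul (j g)) (map j s).
Proof. by rewrite -!map_comp; apply: eq_map => x; rewrite /= jM. Qed.

Lemma bcoch_map n f : bcoch n f -> bcoch n (fun s => f (map j s)).
Proof.
move=> [[M fM] finv]; split; first by exists M => s sz; rewrite fM ?size_map.
by move=> g s sz; rewrite map_hom finv ?size_map.
Qed.

Lemma bcobd_map n f : bcobd n f -> bcobd n (fun s => f (map j s)).
Proof.
move=> [h hb he]; exists (fun s => h (map j s)); first exact: bcoch_map.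
by move=> s sz; rewrite he ?size_map // ds_map.
Qed.

End Pullback.

Section BcochOps.
Variables (G : group) (n : nat).
Implicit Types f g : seq G -> R.

Lemma bcochD f g : bcoch n f -> bcoch n g -> bcoch n (fun s => f s + g s).
Proof.
move=> [[M fM] finv] [[N gN] ginv]; split.
  by exists (M + N) => s sz; apply: le_trans (ler_normD _ _) (lerD _ _); auto.
by move=> x s sz; rewrite finv // ginv.
Qed.

Lemma bcochZ a f : bcoch n f -> bcoch n (fun s => a * f s).
Proof.
move=> [[M fM] finv]; split; last by move=> x s sz; rewrite finv.
by exists (`|a| * M) => s sz; rewrite normrM ler_wpM2l ?fM.
Qed.

Lemma bcochB f g : bcoch n f -> bcoch n g -> bcoch n (fun s => f s - g s).
Proof.
move=> fb gb; apply: (@eq_bcoch _ _ (fun s => f s + (-1) * g s)) => [s _|]; first by rewrite mulN1r.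
exact/bcochD/bcochZ.
Qed.

End BcochOps.

(** * Generalized limits and averages *)

(** A linear functional of norm at most one on bounded sequences that extends the ordinary limit.
    The bound [M] is explicit because boundedness is not part of the type. *)
Definition generalized_limit (L : (nat -> R) -> R) : Prop :=
  [/\ forall (u v : nat -> R) (M : R), (forall n, `|u n| <= M) -> (forall n, `|v n| <= M) ->
        L (fun n => u n + v n) = L u + L v,
      forall (a : R) (u : nat -> R) (M : R), (forall n, `|u n| <= M) -> L (fun n => a * u n) = a * L u,
      forall (u : nat -> R) (M : R), (forall n, `|u n| <= M) -> `|L u| <= M &
      forall (u : nat -> R) (l : R), (forall e : R, 0 < e -> exists N, forall n, (N <= n)%N -> `|u n - l| < e) -> L u = l].

Section UltraLimit.

Context (U : set_system nat) {U_ultra : UltraFilter U} (U_sup : (eventually `<=` U)%classic).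

Let ulim (u : nat -> R) (l : R) := forall e : R, 0 < e -> U [set n | `|u n - l| < e]%classic.

(** The limit is the supremum of the levels that [u] reaches along [U]. A level above it fails along
    [U], and an ultrafilter then contains the complementary set. *)
Let ulim_ex u M : (forall n, `|u n| <= M) -> exists l, ulim u l.
Proof.
move=> uM; pose S : set R := [set r | U [set n | r <= u n]]%classic.
have SM r : S r -> r <= M.
  move=> /filter_ex[n /= le_r]; apply: le_trans le_r _; exact: le_trans (ler_norm _) (uM n).
have S0 : S (- M).
  by apply: filterS filterT => n _ /=; have := uM n; rewrite ler_norml => /andP[].
have Ssup : has_sup S by split; [exists (- M) | exists M => r /SM].
exists (sup S) => e e0.
have [r Sr ltr] := sup_adherent e0 Ssup.
have nS : ~ S (sup S + e / 2).
  by move=> /(sup_upper_bound Ssup); lra.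
have {nS}Sc : U (~` [set n | sup S + e / 2 <= u n])%classic.
  by case: (in_ultra_setVsetC [set n | sup S + e / 2 <= u n]%classic U_ultra).
apply: filterS2 Sr Sc => n /= le_r /negP; rewrite -ltNge => lt_u.
by rewrite ltr_norml; lra.
Qed.

Let ulim_uniq u l l' : ulim u l -> ulim u l' -> l = l'.
Proof.
move=> ul ul'; apply/eqP; rewrite -subr_eq0 -normr_le0 leNgt; apply/negP => d0.
have d2 : 0 < `|l - l'| / 2 by lra.
have [n /= []] := filter_ex (filterI (ul _ d2) (ul' _ d2)).
have := ler_distD (u n) l l'; rewrite (distrC l (u n)); lra.
Qed.

Let L (u : nat -> R) : R := xget 0 (ulim u).

Let LE u l : ulim u l -> L u = l.
Proof. by move=> ul; exact: ulim_uniq (xgetI 0 ul) ul. Qed.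

Let L_lim u M : (forall n, `|u n| <= M) -> ulim u (L u).
Proof. by case/ulim_ex => l ul; rewrite (LE ul). Qed.

Lemma ultra_limit : exists L, generalized_limit L.
Proof.
exists L; split.
- move=> u v M uM vM; apply: LE => e e0; have e2 : 0 < e / 2 by lra.
  apply: filterS2 (L_lim uM e2) (L_lim vM e2) => n /= un vn.
  rewrite (_ : u n + v n - (L u + L v) = (u n - L u) + (v n - L v)); last by ring.
  by apply: le_lt_trans (ler_normD _ _) _; lra.
- move=> a u M uM; apply: LE => e e0.
  have e2 : 0 < e / (`|a| + 1) by rewrite divr_gt0 // ltr_wpDl.
  apply: filterS (L_lim uM e2) => n /= un; rewrite -mulrBr normrM.
  move: un; rewrite ltr_pdivlMr ?ltr_wpDl // mulrDr mulr1 mulrC => un.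
  by apply: le_lt_trans un; rewrite lerDl.
- move=> u M uM; rewrite leNgt; apply/negP => lt_M.
  have d0 : 0 < `|L u| - M by lra.
  have [n /= un] := filter_ex (L_lim uM d0).
  have := uM n; have := ler_distD (u n) (L u) 0; rewrite !subr0 distrC; lra.
- move=> u l ul; apply: LE => e e0; have [N uN] := ul e e0.
  by apply: U_sup; exists N => // n /= leN; exact: uN.
Qed.

End UltraLimit.

Lemma exists_generalized_limit : exists L, generalized_limit L.
Proof.
have [U [U_ultra U_sup]] := ultraFilterLemma eventually_filter.
exact: ultra_limit U_sup.
Qed.

Section GeneralizedLimit.
Variables (L : (nat -> R) -> R) (L_lim : generalized_limit L).

Lemma glimB (u v : nat -> R) (M : R) : (forall i, `|u i| <= M) -> (forall i, `|v i| <= M) ->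
  L (fun i => u i - v i) = L u - L v.
Proof.
have [LD LZ _ _] := L_lim.
move=> uM vM; have -> : (fun i => u i - v i) = (fun i => u i + (-1) * v i).
  by apply/funext => i; rewrite mulN1r.
rewrite (LD _ _ M) // => [|i]; first by rewrite (LZ _ _ M) // mulN1r.
by rewrite mulN1r normrN.
Qed.

Lemma glim_eventually (u : nat -> R) (l : R) N : (forall n, (N <= n)%N -> u n = l) -> L u = l.
Proof.
by have [_ _ _ Ll] := L_lim; move=> ul; apply: Ll => e e0; exists N => n /ul ->; rewrite subrr normr0.
Qed.

Lemma ds_glim (T : Type) k (F : nat -> seq T -> R) (M : R) s :
  (forall m t, size t = k -> `|F m t| <= M) -> size s = k.+1 ->
  ds (fun t => L (fun m => F m t)) s = L (fun m => ds (F m) s).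
Proof.
elim: k F s => [|k IHk] F [|x s] //= FM [sz].
  by case: s sz => // _ /=; rewrite subr0; congr L; apply/funext => m; rewrite subr0.
rewrite IHk // => [|m t st]; last by apply: FM => /=; rewrite st.
have M0 : 0 <= M by apply: le_trans (FM 0%N _ (size_nseq k.+1 x)).
rewrite -(@glimB _ _ (k.+1%:R * M + M)) // => i.
  by apply: le_trans (FM i _ sz) _; rewrite lerDr mulr_ge0.
apply: le_trans (ds_bound (M := M) _ sz) _ => [t st|]; last by rewrite lerDl.
by apply: FM; rewrite /= st.
Qed.

End GeneralizedLimit.

(* The value is 0 when T is empty. *)
Definition avg (T : finType) (f : T -> R) : R := (#|T|%:R)^-1 * \sum_t f t.

Section Avg.
Variable T : finType.
Implicit Types f g : T -> R.

Lemma avgD f g : avg (fun t => f t + g t) = avg f + avg g.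
Proof. by rewrite /avg big_split mulrDr. Qed.

Lemma avgZ a f : avg (fun t => a * f t) = a * avg f.
Proof. by rewrite /avg -mulr_sumr mulrCA. Qed.

Lemma avgN f : avg (fun t => - f t) = - avg f.
Proof. by rewrite /avg sumrN mulrN. Qed.

Lemma avgB f g : avg (fun t => f t - g t) = avg f - avg g.
Proof. by rewrite avgD avgN. Qed.

Lemma eq_avg f g : f =1 g -> avg f = avg g.
Proof. by move=> e; congr (_ * _); apply: eq_bigr. Qed.

Lemma card_gt0R (t0 : T) : 0 < #|T|%:R :> R.
Proof. by rewrite ltr0n; apply/card_gt0P; exists t0. Qed.

Lemma avg_cst (t0 : T) a : avg (fun _ : T => a) = a.
Proof. by rewrite /avg sumr_const -[a *+ _]mulr_natl mulKf // gt_eqF // card_gt0R. Qed.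

Lemma ler_avg f g : (forall t, f t <= g t) -> avg f <= avg g.
Proof. by move=> le; rewrite ler_wpM2l ?invr_ge0 ?ler0n // ler_sum. Qed.

Lemma ler_norm_avg f : `|avg f| <= avg (fun t => `|f t|).
Proof. by rewrite /avg normrM ger0_norm ?invr_ge0 ?ler0n // ler_wpM2l ?invr_ge0 ?ler0n // ler_norm_sum. Qed.

Lemma avg_bound (t0 : T) (M : R) f : (forall t, `|f t| <= M) -> `|avg f| <= M.
Proof. by move=> fM; rewrite (le_trans (ler_norm_avg f)) // -[leRHS](avg_cst t0) ler_avg. Qed.

Lemma reindex_avg (h h' : T -> T) f : cancel h h' -> cancel h' h -> avg (fun t => f (h t)) = avg f.
Proof. by move=> hK h'K; congr (_ * _); rewrite [RHS](reindex h) //; exists h' => t _. Qed.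

End Avg.

Lemma ds_avg (X : Type) (T : finType) (f : T -> seq X -> R) s :
  ds (fun t => avg (fun i => f i t)) s = avg (fun i => ds (f i) s).
Proof. by rewrite /avg dsZ ds_sum. Qed.

(* The expectation of f when the entries of s are perturbed independently. *)
Fixpoint avgseq (T : finType) (X Y : Type) (k : X -> T -> Y) (f : seq Y -> R) (s : seq X) : R :=
  if s is x :: s' then avg (fun t => avgseq k (fun u => f (k x t :: u)) s') else f [::].

Section Avgseq.
Variables (T : finType) (t0 : T) (X Y : Type).
Implicit Types (k : X -> T -> Y) (f g : seq Y -> R) (s : seq X).

Lemma eq_avgseq n k f g s : size s = n -> (forall u, size u = n -> f u = g u) ->
  avgseq k f s = avgseq k g s.
Proof.
elim: n f g s => [|n IHn] f g [|x s] //=; first by move=> _ e; exact: e.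
by move=> [sz] e; apply: eq_avg => t; apply: IHn => // u su; apply: e => /=; rewrite su.
Qed.

Lemma avgseqB k f g s : avgseq k (fun u => f u - g u) s = avgseq k f s - avgseq k g s.
Proof.
elim: s f g => [|x s IHs] f g //=; rewrite -avgB; apply: eq_avg => t; exact: IHs.
Qed.

Lemma avgseq_bound n k f s (M : R) : (forall u, size u = n -> `|f u| <= M) -> size s = n ->
  `|avgseq k f s| <= M.
Proof.
elim: n f s => [|n IHn] f [|x s] //= fM; first by move=> _; apply: fM.
by move=> [sz]; apply: avg_bound => // t; apply: IHn => // u su; apply: fM => /=; rewrite su.
Qed.

(** Deleting an entry leaves a constant to be averaged over its perturbation. Such an average is the
    constant itself only over a nonempty [T], whence [t0]. *)
Lemma ds_avgseq k f s : ds (avgseq k f) s = avgseq k (ds f) s.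
Proof.
elim: s f => [|x s IHs] f //=.
rewrite ds_avg -[X in X - _](avg_cst t0) -avgB; apply: eq_avg => t.
by rewrite IHs -avgseqB.
Qed.

End Avgseq.

Lemma avgseq_comp (T : finType) (X Y Z : Type) (h : Y -> Z) (k : X -> T -> Y) (f : seq Z -> R) s :
  avgseq k (fun u => f (map h u)) s = avgseq (fun x t => h (k x t)) f s.
Proof.
elim: s f => [|x s IHs] f //=; apply: eq_avg => t; exact: (IHs (fun u => f (h (k x t) :: u))).
Qed.

Lemma avgseq_map (T : finType) (X Y Z : Type) (h : Z -> X) (k : X -> T -> Y) (f : seq Y -> R) s :
  avgseq k f (map h s) = avgseq (fun x t => k (h x) t) f s.
Proof. elim: s f => [|x s IHs] f //=; apply: eq_avg => t; exact: IHs. Qed.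

Lemma eq_avgseqk (T : finType) (X Y : Type) (k k' : X -> T -> Y) (f : seq Y -> R) s :
  (forall x t, k x t = k' x t) -> avgseq k f s = avgseq k' f s.
Proof. by move=> e; elim: s f => [|x s IHs] f //=; apply: eq_avg => t; rewrite e IHs. Qed.

Lemma avgseq_cst (T : finType) (t0 : T) (X Y : Type) (k : X -> Y) (f : seq Y -> R) s :
  avgseq (fun x (_ : T) => k x) f s = f (map k s).
Proof. by elim: s f => [|x s IHs] f //=; rewrite IHs avg_cst. Qed.

(* The prism operator makes a cocycle cohomologous to its averages, with uniformly bounded
   primitives, so one can pass to a generalized limit. *)
Section AveragingCriterion.
Variables (G : group).

Hypothesis mixing : forall n (f : seq G -> R), bcoch n f ->
  exists (T : nat -> finType) (t0 : forall m, T m) (w : forall m, T m -> G),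
  forall s s', size s = n -> size s' = n -> forall e : R, 0 < e -> exists N, forall m, (N <= m)%N ->
    `|avgseq (fun x t => gmul x (w m t)) f s - avgseq (fun x t => gmul x (w m t)) f s'| < e.

Lemma averaging_criterion : boundedly_acyclic G.
Proof.
apply/boundedly_acyclicP => n f [fb fc].
have [T [t0 [w mix]]] := mixing fb.
have [L L_lim] := exists_generalized_limit.
have [LD LZ LM Ll] := L_lim.
have [[M fM] finv] := fb.
pose A m s := avgseq (fun x t => gmul x (w m t)) f s.
pose h m s := avgseq (fun x t => (x, gmul x (w m t))) (prism f) s.
have hM m s : size s = n.+1 -> `|h m s| <= n.+1%:R * M.
  move=> sz; apply: (avgseq_bound (t0 m) _ _ sz) => u su.
  exact: prism_bound su.
have AM m s : size s = n.+2 -> `|A m s| <= M.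
  by move=> sz; apply: (avgseq_bound (t0 m) _ _ sz) => u su; exact: fM.
(* Average the prism identity over the pairs [(x, x w)]; the term [prism (ds f)] vanishes because
   [f] is a cocycle. *)
have fE m s : size s = n.+2 -> f s = A m s - ds (h m) s.
  move=> sz; pose k x t := (x, gmul x (w m t)).
  have -> : f s = avgseq k (fun u => f (map fst u)) s.
    by rewrite avgseq_comp (avgseq_cst (t0 m) id) map_id.
  have -> : A m s = avgseq k (fun u => f (map snd u)) s by rewrite avgseq_comp.
  rewrite /h (ds_avgseq (t0 m)) -avgseqB; apply: (eq_avgseq _ sz) => u su.
  have := prism_homotopy f u; rewrite (@eq_prism _ n.+2 (ds f) (fun=> 0)) ?prism0 //; lra.
(* By mixing, the limit of the averages is the same for all arguments, so [f] becomes a constant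
   minus a coboundary. *)
pose c := L (fun m => A m (nseq n.+2 gone)).
have Lc s : size s = n.+2 -> L (fun m => A m s) = c.
  move=> sz; apply/eqP; rewrite -subr_eq0 -(glimB L_lim (M := M)); last 2 first.
  - by move=> m; exact: AM.
  - by move=> m; apply: AM; rewrite size_nseq.
  apply/eqP/Ll => e e0; have [N HN] := mix s (nseq n.+2 gone) sz (size_nseq _ _) e e0.
  by exists N => m leN; rewrite subr0; exact: HN.
pose hL s := L (fun m => h m s).
have hLb : bcoch n.+1 hL.
  split; first by exists (n.+1%:R * M) => s sz; apply: LM => m; exact: hM.
  move=> g s sz; congr L; apply/funext => m; rewrite /h avgseq_map.
  rewrite (@eq_avgseqk _ _ _ _ (fun x t => (fun p => (gmul g p.1, gmul g p.2)) (x, gmul x (w m t)))).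
    rewrite -(@avgseq_comp _ _ _ _ (fun p => (gmul g p.1, gmul g p.2)) (fun x t => (x, gmul x (w m t)))).
    apply: (eq_avgseq _ sz) => u su.
    rewrite prism_map; apply: (@eq_prism _ n.+1) => // t st; exact: finv.
  by move=> x t /=; rewrite gmulA.
have fE' s : size s = n.+2 -> f s = c - ds hL s.
  move=> sz; rewrite (ds_glim L_lim hM sz) -(Lc s sz).
  have M0 : 0 <= M by apply: le_trans (fM _ sz).
  rewrite -(glimB L_lim (M := n.+2%:R * (n.+1%:R * M) + M)) => [|i|i].
  - rewrite (_ : (fun i => _) = (fun=> f s)); last by apply/funext => m; rewrite -fE.
    by apply/esym/Ll => e e0; exists 0%N => m _; rewrite subrr normr0.
  - by apply: le_trans (AM _ _ sz) _; rewrite lerDr !mulr_ge0.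
  - by apply: le_trans (ds_bound (hM i) sz) _; rewrite lerDl.
(* For even [n] the cocycle condition forces [c = 0]. For odd [n] the constant [c] is the coboundary
   of the constant [c], since [n + 2] is odd. *)
case: (boolP (odd n)) => odd_n; last first.
  have c0 : c = 0.
    have sz : size (nseq n.+3 (gone : G)) = n.+3 by rewrite size_nseq.
    have := fc _ sz; rewrite (eq_ds sz fE') dsB ds_ds subr0 ds_cst size_nseq /=.
    by rewrite negbK odd_n.
  exists (fun s => -1 * hL s); first exact: bcochZ.
  by move=> s sz; rewrite fE' // c0 dsZ mulN1r sub0r.
exists (fun s => c - hL s).
  apply: bcochB hLb; split; first by exists `|c|.
  by [].
by move=> s sz; rewrite fE' // dsB ds_cst sz /= negbK odd_n.
Qed.
End AveragingCriterion.

(** * Lamplighter groups *)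

Record is_subgroup (G : group) (P : G -> Prop) : Prop := IsSubgroup {
  subgroup1 : P gone;
  subgroupM : forall x y, P x -> P y -> P (gmul x y);
  subgroupV : forall x, P x -> P (ginv x) }.

Section Subgroup.
Variables (G : group) (P : G -> Prop) (subP : is_subgroup P).

Definition sg_mul (x y : {x : G | P x}) : {x : G | P x} :=
  exist _ (gmul (sval x) (sval y)) (subgroupM subP (svalP x) (svalP y)).
Definition sg_inv (x : {x : G | P x}) : {x : G | P x} :=
  exist _ (ginv (sval x)) (subgroupV subP (svalP x)).
Definition sg_one : {x : G | P x} := exist _ gone (subgroup1 subP).

Lemma sg_mulA x y z : sg_mul x (sg_mul y z) = sg_mul (sg_mul x y) z.
Proof. exact/eq_exist/gmulA. Qed.
Lemma sg_mul1 x : sg_mul sg_one x = x.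
Proof. by case: x => x Px; apply/eq_exist; rewrite gmul1. Qed.
Lemma sg_mulV x : sg_mul (sg_inv x) x = sg_one.
Proof. exact/eq_exist/gmulV. Qed.

Definition subgroup := Defs.Group sg_mulA sg_mul1 sg_mulV.

End Subgroup.

Record selfbij (Z : Type) := SelfBij {
  bfun :> Z -> Z; binv : Z -> Z; bfunK : cancel bfun binv; binvK : cancel binv bfun }.

Lemma bij_ext Z (p q : selfbij Z) : p =1 q -> p = q.
Proof.
case: p q => [f g fK gK] [f' g' fK' gK'] /= /funext e; subst f'.
have e : g = g' by apply/funext => z; rewrite -[z in LHS]gK' fK.
by subst g'; congr SelfBij; exact: Prop_irrelevance.
Qed.

Section BijGroup.
Variable Z : Type.

Definition bmul (p q : selfbij Z) : selfbij Z :=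
  SelfBij (can_comp (bfunK p) (bfunK q)) (can_comp (binvK q) (binvK p)).
Definition binverse (p : selfbij Z) : selfbij Z := SelfBij (binvK p) (bfunK p).
Definition bone : selfbij Z := @SelfBij Z id id (fun=> erefl) (fun=> erefl).

Lemma bmulA p q r : bmul p (bmul q r) = bmul (bmul p q) r.
Proof. exact: bij_ext. Qed.
Lemma bmul1 p : bmul bone p = p.
Proof. exact: bij_ext. Qed.
Lemma bmulV p : bmul (binverse p) p = bone.
Proof. by apply: bij_ext => z /=; rewrite bfunK. Qed.

Definition bij_group := Defs.Group bmulA bmul1 bmulV.
End BijGroup.

Record wreath_of (C : Type) := Wr { wfun : nat -> C; wperm : selfbij nat }.

Lemma wr_ext C (x y : wreath_of C) : wfun x =1 wfun y -> wperm x =1 wperm y -> x = y.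
Proof. by case: x y => [a p] [b q] /= /funext -> /bij_ext ->. Qed.

Section Wreath.
Variable C : group.
Implicit Types x y z : wreath_of C.

Definition wr_mul x y : wreath_of C :=
  Wr (fun i => gmul (wfun x i) (wfun y (binv (wperm x) i))) (bmul (wperm x) (wperm y)).
Definition wr_inv x : wreath_of C :=
  Wr (fun i => ginv (wfun x (wperm x i))) (binverse (wperm x)).
Definition wr_one : wreath_of C := Wr (fun=> gone) (bone nat).

Lemma wr_mulA x y z : wr_mul x (wr_mul y z) = wr_mul (wr_mul x y) z.
Proof. by apply: wr_ext => i //=; rewrite gmulA. Qed.
Lemma wr_mul1 x : wr_mul wr_one x = x.
Proof. by apply: wr_ext => i //=; rewrite gmul1. Qed.
Lemma wr_mulV x : wr_mul (wr_inv x) x = wr_one.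
Proof. by apply: wr_ext => i /=; rewrite ?gmulV ?bfunK. Qed.

Definition wreath := Defs.Group wr_mulA wr_mul1 wr_mulV.

Definition wr_supp m x := forall i, (m <= i)%N -> wfun x i = gone /\ wperm x i = i.

Lemma wr_supp_inv m x i : wr_supp m x -> (m <= i)%N -> binv (wperm x) i = i.
Proof. by move=> sx lei; rewrite -[i in LHS](sx i lei).2 bfunK. Qed.

Lemma wr_supp_le m m' x : (m <= m')%N -> wr_supp m x -> wr_supp m' x.
Proof. by move=> lem sx i lei; apply: sx; apply: leq_trans lei. Qed.

Lemma wr_supp_ltV m x i : wr_supp m x -> (i < m)%N -> (binv (wperm x) i < m)%N.
Proof.
move=> sx ltm; rewrite ltnNge; apply/negP => le_m.
have := (sx _ le_m).2; rewrite binvK => e; by rewrite -e leqNgt ltm in le_m.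
Qed.

Lemma fin_subgroup : is_subgroup (fun x : wreath => exists m, wr_supp m x).
Proof.
split; first by exists 0%N.
  move=> x y [m sx] [m' sy]; exists (maxn m m') => i; rewrite geq_max => /andP[le1 le2] /=.
  by rewrite (wr_supp_inv sx) // (sx i le1).1 (sy i le2).1 (sy i le2).2 gmul1 (sx i le1).2.
move=> x [m sx]; exists m => i lei /=.
by rewrite (wr_supp_inv sx) // (sx i lei).2 (sx i lei).1 ginv1.
Qed.

(* The restricted wreath product of C by the finitary symmetric group of nat. *)
Definition lamp := subgroup fin_subgroup.

End Wreath.

(* Random elements: uniform letters at the positions m <= i < m + k, followed by a uniform
   permutation of the positions below m + k. The positions below m are left free for the
   supports of the arguments of the cochain. *)
Section Bulk.
Variables (C : group) (e : nat -> C) (m k : nat).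

Definition bulk (w : {ffun 'I_k -> 'I_m.+1}) (i : nat) : C :=
  if (i < m)%N then gone else if insub (i - m)%N is Some j then e (w j) else gone.

Definition pext_fun (s : {perm 'I_(m + k)}) (i : nat) : nat :=
  if insub i is Some j then val (s j) else i.

Lemma pext_funK s : cancel (pext_fun s) (pext_fun (s^-1)%g).
Proof.
move=> i; rewrite /pext_fun; case: (insubP _ i) => [j lti ej|ge_i].
  by rewrite valK permK.
by rewrite insubN.
Qed.

Lemma pext_funK' s : cancel (pext_fun (s^-1)%g) (pext_fun s).
Proof. by move=> i; have := pext_funK (s^-1)%g i; rewrite invgK. Qed.

Definition pext s : selfbij nat := SelfBij (pext_funK s) (pext_funK' s).

Lemma pext_funM s t i : pext_fun (s * t)%g i = pext_fun t (pext_fun s i).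
Proof.
rewrite /pext_fun; case: (insubP _ i) => [j lti ej|ge_i]; first by rewrite valK permM.
by rewrite insubN.
Qed.

Lemma pext_out s i : (m + k <= i)%N -> pext_fun s i = i.
Proof. by move=> ge_i; rewrite /pext_fun insubN // -leqNgt. Qed.

Lemma pext_surj (q : selfbij nat) : (forall i, (m + k <= i)%N -> q i = i) -> exists s, q = pext s.
Proof.
move=> qs.
have qlt i : (i < m + k)%N -> (q i < m + k)%N.
  move=> lti; rewrite ltnNge; apply/negP => /[dup] le_q /qs /(can_inj (bfunK q)) e'.
  by rewrite e' leqNgt lti in le_q.
pose f (j : 'I_(m + k)) := Ordinal (qlt j (ltn_ord j)).
have finj : injective f by move=> j j' [/(can_inj (bfunK q))/val_inj].
exists (perm finj); apply: bij_ext => i /=; rewrite /pext_fun.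
case: (insubP _ i) => [j lti ej|]; first by rewrite permE /= ej.
by rewrite -leqNgt => /qs.
Qed.

Definition welt (a : nat -> C) (t : {ffun 'I_k -> 'I_m.+1} * {perm 'I_(m + k)}) : wreath C :=
  Wr (fun i => gmul (a i) (bulk t.1 i)) (pext t.2).

Lemma bulk_out w i : (m + k <= i)%N -> bulk w i = gone.
Proof. by move=> le_i; rewrite /bulk; case: ifP => // _; rewrite insubN //; lia. Qed.

Lemma bulk_in w (j : 'I_k) : bulk w (m + j)%N = e (w j).
Proof.
by rewrite /bulk ltnNge leq_addr /= addKn valK.
Qed.

End Bulk.

Lemma avg_pair (T U : finType) (F : T -> U -> R) :
  avg (fun t => avg (F t)) = avg (fun p : T * U => F p.1 p.2).
Proof.
rewrite /avg card_prod natrM invfM -mulrA; congr (_ * _).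
by rewrite -mulr_sumr -(pair_big xpredT xpredT) /=.
Qed.

Lemma avg_bij (T U : finType) (h : T -> U) (F : U -> R) : bijective h ->
  avg F = avg (fun t => F (h t)).
Proof.
by move=> hb; rewrite /avg (bij_eq_card hb) [in LHS](reindex h) //; exact: onW_bij.
Qed.

(** Nested averages become one average over a single sample space, on which a whole column of
    letters can be exchanged at once. *)
Lemma avgseq_ffun (T : finType) (t0 : T) (X Y : Type) (k : X -> T -> Y) (x0 : X) f s n :
  size s = n -> avgseq k f s =
  avg (fun th : {ffun 'I_n -> T} => f [seq k (nth x0 s i) (th i) | i : 'I_n <- enum 'I_n]).
Proof.
elim: n f s => [|n IHn] f [|x s] //=.
  move=> _; rewrite -[LHS](avg_cst ([ffun=> t0] : {ffun 'I_0 -> T})).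
  by apply: eq_avg => th; congr f; apply/esym/size0nil; rewrite size_map size_enum_ord.
move=> [sz]; under eq_avg do rewrite (IHn _ _ sz).
rewrite avg_pair.
pose h (p : T * {ffun 'I_n -> T}) : {ffun 'I_n.+1 -> T} :=
  [ffun i => if unlift ord0 i is Some j then p.2 j else p.1].
have hb : bijective h.
  exists (fun th : {ffun 'I_n.+1 -> T} => (th ord0, [ffun j => th (lift ord0 j)])).
    move=> [t th]; rewrite /h /= ffunE unlift_none; congr pair.
    by apply/ffunP => j; rewrite !ffunE liftK.
  by move=> th; apply/ffunP => i; rewrite !ffunE; case: unliftP => [j|] -> //=; rewrite ffunE.
rewrite [RHS](avg_bij _ hb); apply: eq_avg => -[t th] /=.
rewrite enum_ordSl /= ffunE unlift_none -map_comp; congr (f (_ :: _)).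
by apply: eq_map => j /=; rewrite ffunE liftK.
Qed.

(* By exchangeability, averaging F t amounts to weighting F by the normalised number of
   columns equal to t, and that number concentrates. *)
Section Exchangeable.
Variables (W T : finType) (k : nat) (col : 'I_k -> W -> T) (F : T -> W -> R) (M : R).
Hypothesis FM : forall t w, `|F t w| <= M.
Hypothesis exch : forall t t' j, exists2 B : W -> W, involutive B &
  [/\ forall w, col j w = t' -> F t w = F t' (B w),
      forall w, col j w = t' -> col j (B w) = t &
      forall w, col j w = t -> col j (B w) = t'].
Hypothesis indep : forall t u j, exists2 B : W -> W, involutive B &
  [/\ forall w, (col j (B w) == t) = (col j w == u),
      forall w, (col j (B w) == u) = (col j w == t) &
      forall w l, l != j -> col l (B w) = col l w].

Let ind (b : bool) : R := b%:R.
Let dif t u j w : R := ind (col j w == t) - ind (col j w == u).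

Let swapE t t' j : avg (fun w => F t w * ind (col j w == t')) = avg (fun w => F t' w * ind (col j w == t)).
Proof.
have [B BK [FB B1 B2]] := exch t t' j.
rewrite -[RHS](reindex_avg _ BK BK); apply: eq_avg => w.
case: (eqVneq (col j w) t') => [e|ne]; first by rewrite (B1 _ e) eqxx FB.
case: (eqVneq (col j (B w)) t) => [/B2|_]; last by rewrite !mulr0.
by rewrite BK => e; rewrite e eqxx in ne.
Qed.

(** Splitting by the value [t'] of column [j] and applying [swapE] moves the dependence on [t] from
    [F] to the event. *)
Let avgFE t j : avg (F t) = \sum_t' avg (fun w => F t' w * ind (col j w == t)).
Proof.
under eq_bigr => t' _ do rewrite -swapE.
rewrite /avg -mulr_sumr exchange_big /=; congr (_ * _); apply: eq_bigr => w _.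
rewrite -mulr_sumr (bigD1 (col j w)) //= eqxx big1 ?addr0 ?mulr1 // => t' ne.
by rewrite eq_sym (negbTE ne).
Qed.

(** Exchanging [t] and [u] in column [l] negates one factor and fixes the other, so distinct columns
    are uncorrelated. *)
Let dif_cov t u j l : j != l -> avg (fun w => dif t u j w * dif t u l w) = 0.
Proof.
move=> ne; have [B BK [B1 B2 B3]] := indep t u l.
set a := avg _; suff : a = - a by lra.
rewrite {1}/a -(reindex_avg _ BK BK) -avgN; apply: eq_avg => w.
rewrite /dif B1 B2 B3 //; ring.
Qed.

Let dif_sq t u j w : dif t u j w ^+ 2 <= 1.
Proof. by rewrite /dif /ind; case: (_ == _); case: (_ == _); rewrite /= expr2; lra. Qed.

Lemma exchangeable_avg (w0 : W) (q : nat) t u : (0 < q)%N -> ((#|T| * q) * (#|T| * q) <= k)%N ->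
  `|avg (F t) - avg (F u)| <= M / q%:R.
Proof.
move=> q0 le_k.
have T0 : (0 < #|T|)%N by apply/card_gt0P; exists t.
have k0 : (0 < k)%N by apply: (leq_trans _ le_k); rewrite !muln_gt0 T0 q0.
have M0 : 0 <= M by apply: le_trans (FM t w0).
pose D w := \sum_j dif t u j w.
(* Summing [avgFE] over all columns brings in [D], the excess of columns showing [t] over columns
   showing [u]. *)
have DE : k%:R * (avg (F t) - avg (F u)) = \sum_t' avg (fun w => F t' w * D w).
  transitivity (\sum_(j < k) \sum_t' avg (fun w => F t' w * dif t u j w)).
    rewrite (eq_bigr (fun=> avg (F t) - avg (F u))) => [|j _].
      by rewrite sumr_const card_ord mulr_natl.
    rewrite (avgFE t j) (avgFE u j) -sumrB; apply: eq_bigr => t' _.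
    by rewrite -avgB; apply: eq_avg => w; rewrite /dif; ring.
  rewrite exchange_big; apply: eq_bigr => t' _; rewrite /avg -mulr_sumr exchange_big; congr (_ * _).
  by apply: eq_bigr => w _; rewrite -mulr_sumr.
(* By [dif_cov] only the [k] diagonal terms survive, each at most one. *)
have D2 : avg (fun w => D w ^+ 2) <= k%:R.
  have -> : avg (fun w => D w ^+ 2) = \sum_j \sum_l avg (fun w => dif t u j w * dif t u l w).
    rewrite /avg; under [RHS]eq_bigr => j _ do rewrite -mulr_sumr.
    rewrite -mulr_sumr; congr (_ * _).
    under [RHS]eq_bigr => j _ do rewrite exchange_big.
    rewrite [RHS]exchange_big; apply: eq_bigr => w _.
    by rewrite expr2 /D mulr_suml; apply: eq_bigr => j _; rewrite mulr_sumr.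
  rewrite -[k in leRHS]card_ord -[leRHS]mulr_natl mulr1 -sumr_const; apply: ler_sum => j _.
  rewrite (bigD1 j) //= big1 ?addr0 => [|l ne]; last by rewrite dif_cov // eq_sym.
  by rewrite -[leRHS](avg_cst w0); apply: ler_avg => w; rewrite -expr2; exact: dif_sq.
have k0R : 0 < k%:R :> R by rewrite ltr0n.
have T0R : 0 < #|T|%:R :> R by rewrite ltr0n.
have q0R : 0 < q%:R :> R by rewrite ltr0n.
(* The weight in [|D| <= c / 2 + D ^ 2 / (2 c)]. The hypothesis on [k] says [k <= c ^ 2], and the
   final bound [#|T| M c / k] equals [M / q]. *)
pose c : R := k%:R / (#|T|%:R * q%:R).
have cE : c = k%:R / (#|T|%:R * q%:R) by [].
have c0 : 0 < c by rewrite divr_gt0 // mulr_gt0.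
clearbody c.
have absD : avg (fun w => `|D w|) <= c.
  have : avg (fun w => `|D w|) <= avg (fun w => c / 2 + (2 * c)^-1 * D w ^+ 2).
    apply: ler_avg => w; have : 0 <= (`|D w| - c) ^+ 2 by rewrite sqr_ge0.
    rewrite sqrrB -normrX ger0_norm ?sqr_ge0 // => le0.
    rewrite -(ler_pM2l (_ : 0 < 2 * c)) ?mulr_gt0 //.
    rewrite (_ : 2 * c * (c / 2 + _) = c ^+ 2 + D w ^+ 2); last by field; rewrite gt_eqF.
    by move: le0; rewrite -[_ *+ 2]mulr_natl; lra.
  rewrite avgD (avg_cst w0) avgZ => /le_trans; apply.
  have le_c : k%:R <= c ^+ 2.
    rewrite cE expr_div_n ler_pdivlMr ?exprn_gt0 ?mulr_gt0 // [leRHS]expr2 ler_pM2l //.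
    by rewrite expr2 -!natrM ler_nat.
  have c20 : 0 < (2 * c)^-1 by rewrite invr_gt0 mulr_gt0.
  have := le_trans D2 le_c; rewrite -(ler_pM2l c20).
  rewrite [X in _ <= X -> _](_ : _ = c / 2); last by field; rewrite gt_eqF.
  by lra.
rewrite -(ler_pM2l k0R) -[X in X * _ <= _]ger0_norm ?ler0n // -normrM DE.
apply: le_trans (ler_norm_sum _ _ _) _.
apply: (@le_trans _ _ (\sum_(t' : T) M * c)).
  apply: ler_sum => t' _; apply: le_trans (ler_norm_avg _) _.
  apply: (@le_trans _ _ (avg (fun w => M * `|D w|))).
    by apply: ler_avg => w; rewrite normrM ler_wpM2r.
  by rewrite avgZ ler_wpM2l.
rewrite sumr_const -[_ *+ _]mulr_natl cE.
rewrite le_eqVlt; apply/orP; left; apply/eqP; field.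
by rewrite !gt_eqF.
Qed.
End Exchangeable.

Fixpoint every (X : Type) (P : X -> Prop) (s : seq X) : Prop :=
  if s is x :: s' then P x /\ every P s' else True.

Lemma every_nth X (P : X -> Prop) x0 s : every P s -> forall i, (i < size s)%N -> P (nth x0 s i).
Proof. by elim: s => [|x s IHs] //= [Px Ps] [|i] //= lti; apply: IHs. Qed.

Lemma every_impl X (P Q : X -> Prop) s : (forall x, P x -> Q x) -> every P s -> every Q s.
Proof. by move=> PQ; elim: s => [|x s IHs] //= [/PQ Qx /IHs]. Qed.

Lemma every_bound X (P : nat -> X -> Prop) s : (forall m m' x, (m <= m')%N -> P m x -> P m' x) ->
  (forall x, exists m, P m x) -> exists m, every (P m) s.
Proof.
move=> Pmono Pex; elim: s => [|x s [m IHs]]; first by exists 0%N.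
have [m' Px] := Pex x; exists (maxn m m'); split; first exact: Pmono (leq_maxr _ _) Px.
by apply: every_impl IHs => y; apply: Pmono; exact: leq_maxl.
Qed.

(** Entries are perturbed independently, so only the distribution of each perturbed entry
    matters. *)
Lemma eq_avgseq_every (T : finType) (X X' Y : Type) (k : X -> T -> Y) (k' : X' -> T -> Y) (h : X -> X')
    (P : X -> Prop) f s :
  (forall x, P x -> forall F : Y -> R, avg (fun t => F (k x t)) = avg (fun t => F (k' (h x) t))) ->
  every P s -> avgseq k f s = avgseq k' f (map h s).
Proof.
move=> kk'; elim: s f => [|x s IHs] f //= [Px Ps].
rewrite (kk' x Px (fun y => avgseq k (fun u => f (y :: u)) s)).
by apply: eq_avg => t; apply: IHs.
Qed.

(** * Mixing in lamplighter groups *)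

Section LampMixing.
Variables (C : group) (e : nat -> C).

(** The default [gone] outside finite support makes [lw] total; [lwE] covers the supported case. *)
Definition to_lamp (x : wreath C) : lamp C :=
  if pselect (exists m, wr_supp m x) is left p then exist _ x p else gone.

Lemma to_lampK x : (exists m, wr_supp m x) -> sval (to_lamp x) = x.
Proof. by rewrite /to_lamp; case: pselect. Qed.

Lemma lamp_ext (x y : lamp C) : sval x = sval y -> x = y.
Proof. by case: x y => [x px] [y py] /= exy; exact: eq_exist. Qed.

Definition upd (a : nat -> C) (l : nat) (c : C) : nat -> C := fun i => if i == l then c else a i.

Section Fixed.
Variables m k : nat.

Notation TT := ({ffun 'I_k -> 'I_m.+1} * {perm 'I_(m + k)})%type.

Definition lw (a : nat -> C) (t : TT) : lamp C := to_lamp (welt e a t).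

Definition asupp (M : nat) (a : nat -> C) := forall i, (M <= i)%N -> a i = gone.

Lemma lwE a t : asupp m a -> sval (lw a t) = welt e a t.
Proof.
move=> sa; apply: to_lampK; exists (m + k)%N => i lei /=; split; last by rewrite pext_out.
by rewrite sa ?bulk_out ?gmul1 //; apply: leq_trans lei; exact: leq_addr.
Qed.

Lemma bulk_perm (q : selfbij nat) (w : {ffun 'I_k -> 'I_m.+1}) i : wr_supp m (Wr (fun=> gone : C) q) -> bulk e w (binv q i) = bulk e w i :> C.
Proof.
move=> sq; case: (ltnP i m) => [lti|lei].
  by rewrite /bulk lti (wr_supp_ltV sq lti).
by rewrite (wr_supp_inv sq lei).
Qed.

(** The permutation of [x] is absorbed by the uniform random permutation and fixes the positions
    from [m] on, where the random letters sit. Only the letters of [x] remain. *)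
Lemma avg_proj (x : lamp C) : wr_supp m (sval x) -> forall F : lamp C -> R,
  avg (fun t : TT => F (gmul x (lw (fun=> gone) t))) = avg (fun t : TT => F (lw (wfun (sval x)) t)).
Proof.
move=> sx F.
have [s sE] : exists s : {perm 'I_(m + k)}, wperm (sval x) = pext s.
  by apply: pext_surj => i lei; apply: (sx i _).2; apply: leq_trans lei; exact: leq_addr.
have hK : cancel (fun t : TT => (t.1, (t.2 * s)%g)) (fun t : TT => (t.1, (t.2 * s^-1)%g)).
  by move=> [t1 t2] /=; rewrite mulgK.
have h'K : cancel (fun t : TT => (t.1, (t.2 * s^-1)%g)) (fun t : TT => (t.1, (t.2 * s)%g)).
  by move=> [t1 t2] /=; rewrite mulgVK.
rewrite -[RHS](reindex_avg _ hK h'K); apply: eq_avg => t; congr F; apply: lamp_ext.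
have sa : asupp m (wfun (sval x)) by move=> i /sx[].
rewrite /= !lwE //; apply: wr_ext => i /=.
  rewrite gmul1 bulk_perm // => j lej; split=> //=; exact: (sx j lej).2.
by rewrite pext_funM sE.
Qed.

Section Swap.
Variable n : nat.
Notation W := {ffun 'I_n -> TT}.
Notation T := {ffun 'I_n -> 'I_m.+1}.

(** A column collects the random letters that the [n] arguments carry at position [m + j]. *)
Definition col (j : 'I_k) (th : W) : T := [ffun i => (th i).1 j].

(** With [g] a swap of two column values, this provides the involutions of [exch] (with [s] a
    transposition) and of [indep] (with [s] trivial). *)
Definition tweak (g : T -> T) (s : {perm 'I_(m + k)}) (j : 'I_k) (th : W) : W :=
  [ffun i => ([ffun j' => if j' == j then g (col j th) i else (th i).1 j'], ((th i).2 * s)%g)].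

Lemma col_tweak g s j th : col j (tweak g s j th) = g (col j th).
Proof. by apply/ffunP => i; rewrite !ffunE /= eqxx. Qed.

Lemma col_tweak_neq g s j th j' : j' != j -> col j' (tweak g s j th) = col j' th.
Proof. by move=> ne; apply/ffunP => i; rewrite !ffunE /= (negbTE ne). Qed.

Lemma tweakK g s j : involutive g -> (s * s)%g = 1%g -> involutive (tweak g s j).
Proof.
move=> gK ss th; apply/ffunP => i; rewrite ffunE col_tweak gK.
rewrite [RHS]surjective_pairing; congr pair; last by rewrite ffunE /= -mulgA ss mulg1.
by apply/ffunP => j'; rewrite !ffunE /=; case: eqP => [->|ne]; rewrite ?ffunE //; case: eqP.
Qed.

Definition swap (t u : T) (c : T) := if c == t then u else if c == u then t else c.

Lemma swapK t u : involutive (swap t u).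
Proof.
move=> c; rewrite /swap; case: (eqVneq c t) => [->|ct].
  by rewrite eqxx; case: eqP.
by case: (eqVneq c u) => [->|cu]; rewrite ?eqxx // (negbTE ct) (negbTE cu).
Qed.

Variables (f : seq (lamp C) -> R) (M : R).
Hypothesis fM : forall s, size s = n -> `|f s| <= M.
Hypothesis finv : forall g s, size s = n -> f (map (gmul g) s) = f s.
Variables (A : seq (nat -> C)) (l : nat).
Hypotheses (sA : size A = n) (lm : (l < m)%N) (Asupp : every (asupp m) A).

Let F (t : T) (th : W) : R :=
  f [seq lw (upd (nth (fun=> gone) A i) l (e (t i))) (th i) | i : 'I_n <- enum 'I_n].

Let updsupp (i : 'I_n) c : asupp m (upd (nth (fun=> gone) A i) l c).
Proof.
move=> x lex; rewrite /upd; case: eqP => [ex|_]; first by rewrite ex leqNgt lm in lex.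
by have /(_ (fun=> gone) i) := every_nth _ Asupp; apply; rewrite ?sA.
Qed.

(** Left multiplication by the transposition of the positions [l] and [m + j] preserves [f]. It
    exchanges the letters at [l] with column [j], and the random permutations absorb it. *)
Let Fswap t t' (j : 'I_k) th (P : (l < m + k)%N) (P' : (m + j < m + k)%N) : col j th = t' ->
  F t th = F t' (tweak (swap t t') (tperm (Ordinal P) (Ordinal P')) j th).
Proof.
move=> cj; set s := tperm _ _.
pose g := to_lamp (Wr (fun=> gone) (pext s)).
have gE : sval g = Wr (fun=> gone) (pext s).
  by apply: to_lampK; exists (m + k)%N => i lei; rewrite /= pext_out.
rewrite /F -[LHS](finv g); last by rewrite size_map size_enum_ord.
congr f; rewrite -map_comp; apply: eq_map => i /=.
apply: lamp_ext; rewrite lwE // /= gE lwE //; apply: wr_ext => x /=; last first.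
  by rewrite ffunE /= pext_funM.
rewrite gmul1 tpermV -/s.
have lE : pext_fun s l = (m + j)%N.
  by rewrite /pext_fun insubT /= [Sub _ _](_ : _ = Ordinal P) ?tpermL //; apply: val_inj.
have jE : pext_fun s (m + j)%N = l.
  by rewrite /pext_fun insubT /= [Sub _ _](_ : _ = Ordinal P') ?tpermR //; apply: val_inj.
have aE c : upd (nth (fun=> gone) A i) l c (m + j)%N = gone by apply: updsupp; exact: leq_addr.
have bl (w : {ffun 'I_k -> 'I_m.+1}) : bulk e w l = gone :> C by rewrite /bulk lm.
have cjE : (th i).1 j = t' i by rewrite -cj ffunE.
case: (eqVneq x l) => [->|xl].
  by rewrite lE aE gmul1 bulk_in bl gmulr1 /upd eqxx cjE.
case: (eqVneq x (m + j)%N) => [->|xj].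
  rewrite jE aE bl gmulr1 gmul1 bulk_in ffunE /= ffunE eqxx cj /swap eqxx /upd eqxx.
  by case: eqP => [->|].
have xE : pext_fun s x = x.
  rewrite /pext_fun; case: insubP => // y lty yE; rewrite tpermD //.
    by apply: contra xl => /eqP yP; rewrite -yE -yP.
  by apply: contra xj => /eqP yP; rewrite -yE -yP.
rewrite xE /upd (negbTE xl); congr gmul; rewrite /bulk; case: ifP => // /negbT; rewrite -leqNgt => lex.
case: insubP => // y lty yE; rewrite ffunE /= ffunE ifN //.
by apply: contra xj => /eqP yj; rewrite -yj yE subnKC.
Qed.

(** The letters at position [l] of all arguments are hidden among the [k] random columns, so
    replacing them changes the average little. *)
Lemma letter_change q t u : (0 < q)%N -> ((#|T| * q) * (#|T| * q) <= k)%N ->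
  `|avg (F t) - avg (F u)| <= M / q%:R.
Proof.
move=> q0 le_k; apply: (@exchangeable_avg W T k col F M _ _ _ _ q t u) => //.
- by move=> t' w; apply: fM; rewrite size_map size_enum_ord.
- move=> {t u} t t' j.
  have P : (l < m + k)%N by apply: leq_trans lm _; exact: leq_addr.
  have P' : (m + j < m + k)%N by rewrite ltn_add2l.
  exists (tweak (swap t t') (tperm (Ordinal P) (Ordinal P')) j).
    by apply: tweakK; [exact: swapK | exact: tperm2].
  split=> w cw; first exact: Fswap.
    by rewrite col_tweak cw /swap eqxx; case: eqP.
  by rewrite col_tweak cw /swap eqxx.
- move=> {t u} t u j; exists (tweak (swap t u) 1%g j).
    by apply: tweakK; [exact: swapK | exact: mulg1].
  split=> [w|w|w j' ne]; [rewrite col_tweak /swap | rewrite col_tweak /swap | exact: col_tweak_neq].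
    case: (eqVneq (col j w) t) => [->|ct]; first by rewrite eq_sym.
    by case: (eqVneq (col j w) u) => _; rewrite ?eqxx // (negbTE ct).
  case: (eqVneq (col j w) t) => [_|ct]; first by rewrite eqxx.
  by case: (eqVneq (col j w) u) => [<-|/negbTE->//]; rewrite eq_sym (negbTE ct).
- exact: [ffun i => ([ffun=> ord0], 1%g)].
Qed.

End Swap.
End Fixed.
End LampMixing.

Lemma every_map X Y (h : X -> Y) (P : Y -> Prop) s : every (fun x => P (h x)) s -> every P (map h s).
Proof. by elim: s => [|x s IHs] //= [Px /IHs]. Qed.

Definition countable_type (X : Type) := exists c : X -> nat, injective c.

Lemma countable_enum (X : Type) (x0 : X) : countable_type X -> exists e : nat -> X, forall x, exists i, e i = x.
Proof.
move=> [c cinj]; have /choice[e eP] : forall i, exists x, (exists y, c y = i) -> c x = i.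
  move=> i; have [[y yi]|n] := pselect (exists y, c y = i); first by exists y.
  by exists x0.
by exists e => x; exists (c x); apply: cinj; apply: eP; exists x.
Qed.

Section LampAcyclic.
Variable C : group.
Hypothesis C_countable : countable_type C.

Definition trunc (l : nat) (a : nat -> C) : nat -> C := fun i => if (i < l)%N then gone else a i.

Lemma lamp_acyclic : boundedly_acyclic (lamp C).
Proof.
have [e e_surj] := countable_enum (gone : C) C_countable.
apply: averaging_criterion => n f [[M fM] finv].
(* The least [k] that [letter_change] allows with parameter [m + 1]; its error is then
   [M / (m + 1)]. *)
pose q m := (#|{ffun 'I_n -> 'I_m.+1}| * m.+1)%N; pose k m := (q m * q m)%N.
pose T m : finType := ({ffun 'I_(k m) -> 'I_m.+1} * {perm 'I_(m + k m)})%type.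
pose t0 m : T m := ([ffun=> ord0], 1%g).
pose av m (s : seq (nat -> C)) : R := avgseq (fun a (t : T m) => lw e a t) f s.
exists T, t0, (fun m t => lw e (fun=> gone) t).
(* It suffices to compare each tuple with the one whose letters are all trivial. *)
suff conv s : size s = n -> forall d : R, 0 < d -> exists N, forall m, (N <= m)%N ->
    `|avgseq (fun x (t : T m) => gmul x (lw e (fun=> gone) t)) f s - av m (nseq n (fun=> gone))| < d.
  move=> s s' sz sz' d d0; have d2 : 0 < d / 2 by lra.
  have [N HN] := conv s sz _ d2; have [N' HN'] := conv s' sz' _ d2.
  exists (maxn N N') => m; rewrite geq_max => /andP[/HN lt1 /HN' lt2].
  apply: le_lt_trans (ler_distD (av m (nseq n (fun=> gone))) _ _) _.
  by rewrite [X in _ + X]distrC; lra.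
move=> sz d d0.
have M0 : 0 <= M by apply: le_trans (fM (nseq n gone) (size_nseq _ _)).
have [L sL] : exists L, every (fun x => wr_supp L (sval x)) s.
  apply: (@every_bound _ (fun L (x : lamp C) => wr_supp L (sval x))) => [m m' x|x]; first exact: wr_supp_le.
  by case: x.
have [i0 ei0] := e_surj gone.
have [N0 sN0] : exists N0, every (fun x : lamp C => forall l, (l < L)%N ->
    exists2 i, (i <= N0)%N & e i = wfun (sval x) l) s.
  apply: (@every_bound _ (fun N0 (x : lamp C) => forall l, (l < L)%N ->
    exists2 i, (i <= N0)%N & e i = wfun (sval x) l)) => [m m' x lem H l /H[i lei ei]|x].
    by exists i => //; exact: leq_trans lem.
  elim: L {sL} => [|L [N IHL]]; first by exists 0%N.
  have [i ei] := e_surj (wfun (sval x) L); exists (maxn N i) => l.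
  rewrite ltnS leq_eqVlt => /orP[/eqP->|/IHL[j lej ej]]; first by exists i => //; exact: leq_maxr.
  by exists j => //; apply: leq_trans lej (leq_maxl _ _).
pose a := map (fun x : lamp C => wfun (sval x)) s.
have sza : size a = n by rewrite size_map.
have aL : every (asupp L) a.
  by apply: every_map; apply: every_impl sL => x sx i /sx[].
have aN0 : every (fun b : nat -> C => forall l, (l < L)%N -> exists2 i, (i <= N0)%N & e i = b l) a.
  exact: every_map.
have [N1 HN1] : exists N1 : nat, L%:R * M / d < N1%:R.
  by exists (Num.Def.truncn (L%:R * M / d)).+1; rewrite truncnS_gt.
(* For such [m] all supports lie below [m], all letters in use and the trivial one occur among the
   first [m + 1] of the enumeration, and [L] errors add up to less than [d]. *)
exists (maxn (maxn L N0) (maxn i0 N1)) => m; rewrite !geq_max => /andP[/andP[leL leN0] /andP[lei0 leN1]].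
(* One step of a hybrid argument: the letters at position [l] are made trivial in all arguments
   simultaneously. *)
have step l : (l < L)%N -> `|av m (map (trunc l) a) - av m (map (trunc l.+1) a)| <= M / m.+1%:R.
  move=> ltl.
  have szA : size (map (trunc l.+1) a) = n by rewrite size_map.
  have /choice[g gE] : forall i : 'I_n, exists j : 'I_m.+1, e j = nth (fun=> gone) a i l.
    move=> i; have lti : (i < size a)%N by rewrite sza.
    have [j lej ej] := @every_nth _ _ (fun=> gone) _ aN0 i lti l ltl.
    by exists (inord j); rewrite inordK // ltnS (leq_trans lej).
  have AE l' (t : {ffun 'I_n -> 'I_m.+1}) :
      (forall i : 'I_n, upd (nth (fun=> gone) (map (trunc l.+1) a) i) l (e (t i)) =
                        nth (fun=> gone) (map (trunc l') a) i) ->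
      av m (map (trunc l') a) = avg (fun th : {ffun 'I_n -> T m} =>
        f [seq lw e (upd (nth (fun=> gone) (map (trunc l.+1) a) i) l (e (t i))) (th i) | i : 'I_n <- enum 'I_n]).
    move=> tE; rewrite /av (@avgseq_ffun _ (t0 m) _ _ _ (fun=> gone) f _ n) ?size_map //.
    by apply: eq_avg => th; congr f; apply: eq_map => i; rewrite tE.
  rewrite (AE l [ffun i => g i]) => [|i]; last first.
    rewrite !(nth_map (fun=> gone)) ?sza // ffunE gE; apply/funext => x; rewrite /upd /trunc.
    by case: eqP => [->|/eqP ne]; rewrite ?ltnn // ltnS leq_eqVlt (negbTE ne).
  rewrite (AE l.+1 [ffun=> inord i0]) => [|i]; last first.
    rewrite !(nth_map (fun=> gone)) ?sza // ffunE inordK ?ltnS // ei0; apply/funext => x; rewrite /upd /trunc.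
    by case: eqP => [->|//]; rewrite ltnSn.
  apply: letter_change => //; first exact: leq_trans leL.
  apply: every_map; apply: every_impl aL => b sb i lei; rewrite /trunc; case: ifP => // _.
  by apply: sb; apply: leq_trans lei.
have hyb l : (l <= L)%N -> `|av m (map (trunc 0) a) - av m (map (trunc l) a)| <= l%:R * (M / m.+1%:R).
  elim: l => [|l IHl] lel; first by rewrite subrr normr0 mul0r.
  rewrite -natr1 mulrDl mul1r; apply: le_trans (ler_distD (av m (map (trunc l) a)) _ _) _.
  by apply: lerD; [apply: IHl; exact: ltnW | exact: step].
have -> : avgseq (fun x (t : T m) => gmul x (lw e (fun=> gone) t)) f s = av m (map (trunc 0) a).
  have -> : map (trunc 0) a = a by rewrite -[RHS]map_id; apply: eq_map => b; apply/funext.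
  apply: (@eq_avgseq_every _ _ _ _ _ _ _ (fun x => wr_supp m (sval x))).
    by move=> x sx F; exact: avg_proj.
  by apply: every_impl sL => x; exact: wr_supp_le.
have -> : nseq n (fun=> gone) = map (trunc L) a.
  rewrite -sza; elim: (a) aL => [|b a' IHa] //= [sb /IHa <-]; congr (_ :: _).
  by apply/funext => i; rewrite /trunc; case: ltnP => // /sb.
apply: le_lt_trans (hyb L (leqnn L)) _.
rewrite mulrA ltr_pdivrMr // -ltr_pdivrMl // mulrC.
by apply: lt_le_trans HN1 _; rewrite ler_nat; apply: leqW.
Qed.

End LampAcyclic.

(** * Suspension of a bounded class *)

Section ReducedWords.
Variables (E : eqType) (X : Type).

Definition reduced (w : seq E) := sorted (fun a b => a != b) w.

(** Left multiplication by the involution [s] on reduced words. *)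
Definition toggle (s : E) (w : seq E) :=
  if w is s' :: w' then if s' == s then w' else s :: w else [:: s].

Lemma reduced_toggle s w : reduced w -> reduced (toggle s w).
Proof.
case: w => [|a w] //=; case: eqP => [_ /path_sorted //|/eqP ne r].
by rewrite /= eq_sym ne.
Qed.

Lemma toggleK s w : reduced w -> toggle s (toggle s w) = w.
Proof.
case: w => [|a w] /=; first by rewrite eqxx.
case: (eqVneq a s) => [->|ne] /=; last by rewrite eqxx.
by case: w => [|b w] //= /andP[/negbTE ne _]; rewrite eq_sym ne.
Qed.

(* The vertices of the Cayley tree of the free product of copies of Z/2 indexed by E,
   decorated with a frame. *)
Record pt := Pt { word : seq E; frame : X; word_red : reduced word }.

Lemma pt_ext z z' : word z = word z' -> frame z = frame z' -> z = z'.
Proof.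
case: z z' => [w a r] [w' a' r'] /= ew ea; subst w' a'.
by congr Pt; exact: bool_irrelevance.
Qed.

Definition flip_fun s z := Pt (frame z) (reduced_toggle s (word_red z)).

Lemma flip_funK s : cancel (flip_fun s) (flip_fun s).
Proof. by move=> z; apply: pt_ext => //=; rewrite toggleK // word_red. Qed.

Definition flip s : bij_group pt := SelfBij (flip_funK s) (flip_funK s).

Lemma flip2 s : gmul (flip s) (flip s) = gone.
Proof. by apply: bij_ext => z /=; rewrite flip_funK. Qed.

Lemma flipV s : ginv (flip s) = flip s.
Proof. by apply: bij_ext. Qed.

Lemma word_flip_cons s z w : word z = s :: w -> word (flip s z) = w.
Proof. by move=> e; rewrite /= e /= eqxx. Qed.

Lemma word_flip_neq s z : ohead (word z) != Some s -> word (flip s z) = s :: word z.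
Proof. by rewrite /=; case: (word z) => [|a w] //=; case: (eqVneq a s) => [->|//]; rewrite eqxx. Qed.

End ReducedWords.

Lemma bij_mulE (Z : Type) (p q : bij_group Z) z : bfun (gmul p q) z = bfun p (bfun q z).
Proof. by []. Qed.

Lemma bij_invE (Z : Type) (p : bij_group Z) z : bfun (ginv p) z = binv p z.
Proof. by []. Qed.

(** * The wreath product acting on the tree, and path sums *)

Section Tree.
Variable C : group.

(* A letter (i, a) stands for the line in direction i through a in the Hamming space
   nat -> C; the entry a i is a dummy, which act leaves untouched. *)
Definition letter : eqType := {classic (nat * (nat -> C))}.
Definition dir (s : letter) : nat := s.1.
Definition coor (s : letter) : nat -> C := s.2.

Definition act (b : wreath C) (s : letter) : letter :=
  (wperm b (dir s), fun j => if j == wperm b (dir s) then coor s (dir s)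
                             else gmul (wfun b j) (coor s (binv (wperm b) j))).

Lemma actM b b' s : act (gmul b b') s = act b (act b' s).
Proof.
rewrite /act /dir /coor /=; congr pair; apply/funext => j /=.
case: eqVneq => [_|ne]; first by rewrite eqxx.
by case: eqVneq => [e|_]; [rewrite -e binvK eqxx in ne | rewrite gmulA].
Qed.

Lemma act1 s : act gone s = s.
Proof.
case: s => i a; rewrite /act /dir /coor /=; congr pair; apply/funext => j /=.
by case: eqP => [->|_] //; rewrite gmul1.
Qed.

Lemma actK b : cancel (act b) (act (ginv b)).
Proof. by move=> s; rewrite -actM gmulV act1. Qed.

Notation Z := (pt letter (wreath C)).

Lemma reduced_act b w : reduced w -> reduced (map (act b) w).
Proof.
rewrite /reduced sorted_map; apply: sub_sorted => s t /= ne.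
by rewrite (inj_eq (can_inj (actK b))).
Qed.

Definition mv_fun b (z : Z) : Z := Pt (gmul b (frame z)) (reduced_act b (word_red z)).

Lemma mv_funM b b' z : mv_fun (gmul b b') z = mv_fun b (mv_fun b' z).
Proof.
apply: pt_ext => /=; last by rewrite (wr_mulA b).
by rewrite -map_comp; apply: eq_map => s /=; rewrite -actM.
Qed.

Lemma mv_fun1 z : mv_fun gone z = z.
Proof.
apply: pt_ext; last exact: gmul1.
by rewrite /= -[RHS]map_id; apply: eq_map => s; exact: act1.
Qed.

Lemma mv_funK b : cancel (mv_fun b) (mv_fun (ginv b)).
Proof. by move=> z; rewrite -mv_funM gmulV mv_fun1. Qed.

Lemma mv_funVK b : cancel (mv_fun (ginv b)) (mv_fun b).
Proof. by move=> z; rewrite -mv_funM gmulVr mv_fun1. Qed.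

Definition mv b : bij_group Z := SelfBij (mv_funK b) (mv_funVK b).

Lemma mvM : is_hom mv.
Proof. by move=> b b'; apply: bij_ext => z; exact: mv_funM. Qed.

Lemma mv_flip b s : gmul (mv b) (flip _ s) = gmul (flip _ (act b s)) (mv b).
Proof.
apply: bij_ext => z; apply: pt_ext => //=.
case: (word z) => [|a w] //=; rewrite (inj_eq (can_inj (actK b))).
by case: ifP.
Qed.

(** The nearest-point projection to the subtree of direction [i] through the root. Letters of
    direction [i] are edges inside it; the first other letter is the exit and its [i]-th coordinate
    is recorded. Without an exit the frame supplies the value. *)
Fixpoint phiw (i : nat) (w : seq letter) (a : wreath C) : C :=
  if w is s :: w' then if dir s == i then phiw i w' a else coor s i else wfun a i.

Definition phi i (z : Z) : C := phiw i (word z) (frame z).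

Lemma phi_flip s z : phi (dir s) (flip _ s z) = phi (dir s) z.
Proof.
rewrite /phi /=; case: (word z) => [|a w] /=; first by rewrite eqxx.
by case: (eqVneq a s) => [->|ne] /=; rewrite eqxx.
Qed.

Lemma phi_mv i b z : phi i (mv b z) = gmul (wfun b i) (phi (binv (wperm b) i) z).
Proof.
rewrite /phi /=; elim: (word z) => [|s w IHw] //=.
rewrite {1}/act /dir /= -/(dir s).
case: (eqVneq (wperm b (dir s)) i) => [e|ne].
  by rewrite IHw -e bfunK eqxx.
case: (eqVneq (dir s) _) => [e|_]; first by rewrite e binvK eqxx in ne.
by [].
Qed.

Lemma phi_head i z s w : word z = s :: w -> dir s != i -> phi i z = coor s i.
Proof. by rewrite /phi => -> /= /negbTE ->. Qed.

Notation P := (bij_group Z).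
Implicit Type K : P -> nat -> R.

(* K is thought of as a function on the subtrees spanned by the letters of a given direction. *)
Definition class_fun K :=
  (forall v s, K (gmul v (flip _ s)) (dir s) = K v (dir s)) /\
  (forall v b i, K (gmul v (mv b)) i = K v (wperm b i)).

Definition shift (g : P) K : P -> nat -> R := fun v => K (gmul g v).

Lemma class_shift g K : class_fun K -> class_fun (shift g K).
Proof. by move=> [K1 K2]; split=> *; rewrite /shift gmulA ?K1 ?K2. Qed.

Lemma shiftM g h K : shift h (shift g K) = shift (gmul g h) K.
Proof. by apply/funext => v; rewrite /shift gmulA. Qed.

Lemma shift1 K : shift gone K = K.
Proof. by apply/funext => v; rewrite /shift gmul1. Qed.

(* The alternating sum telescopes along the edges of a path lying in one subtree. *)
Fixpoint pathsum (w : seq letter) K : R :=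
  if w is s :: w' then K gone (dir s) - pathsum w' (shift (flip _ s) K) else 0.

(** When the first letter cancels, the backtracked edge contributes two values of [K] at vertices of
    one subtree, and these agree. *)
Lemma pathsum_flip s (z : Z) K : class_fun K ->
  pathsum (word (flip _ s z)) K = K gone (dir s) - pathsum (word z) (shift (flip _ s) K).
Proof.
move=> [K1 K2] /=; case: (word z) => [|a w] //=; case: eqVneq => [->|ne] //=.
rewrite shiftM flip2 shift1 /shift gmulr1 -[flip _ s](gmul1 (flip _ s)) K1; lra.
Qed.

Lemma pathsum_mv b (z : Z) K : class_fun K ->
  pathsum (word (mv b z)) K = pathsum (word z) (shift (mv b) K).
Proof.
rewrite /=; elim: (word z) K => [|s w IHw] K //= Kc.
rewrite {1}/dir /= -/(dir s) IHw ?shiftM; last exact: class_shift.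
rewrite -mv_flip; congr (_ - _); rewrite /shift gmulr1.
by rewrite -[mv b]gmul1 (Kc.2 gone b).
Qed.

Definition origin : Z := @Pt letter (wreath C) [::] gone isT.

(** The path to [g z] is the path to [g origin] followed by the translate of the path to [z]. The
    sign [e] is the parity of the number of flips in [g], which shifts the alternation. *)
Definition additive_at (e : R) (g : P) := forall z K, class_fun K ->
  pathsum (word (g z)) K = pathsum (word (g origin)) K + e * pathsum (word z) (shift g K).

Lemma additive_flip s : additive_at (-1) (flip _ s).
Proof. by move=> z K Kc; rewrite !pathsum_flip //=; lra. Qed.

Lemma additive_mv b : additive_at 1 (mv b).
Proof. by move=> z K Kc; rewrite !pathsum_mv //=; lra. Qed.

Lemma additive_mul e e' g h : additive_at e g -> additive_at e' h -> additive_at (e * e') (gmul g h).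
Proof.
move=> ga ha z K Kc; rewrite !bij_mulE (ga (h z)) // (ga (h origin)) //.
by rewrite (ha z) ?shiftM; [ring | exact: class_shift].
Qed.

Lemma additive_one : additive_at 1 gone.
Proof. by move=> z K Kc; rewrite shift1 /=; lra. Qed.

Lemma additive_inv g : additive_at 1 g -> additive_at 1 (ginv g).
Proof.
move=> ga z K Kc; have Kc' := class_shift (ginv g) Kc.
have e y : pathsum (word (ginv g y)) K =
    pathsum (word y) (shift (ginv g) K) - pathsum (word (g origin)) (shift (ginv g) K).
  have := ga (ginv g y) _ Kc'; rewrite shiftM gmulV shift1 bij_invE /= binvK; lra.
by rewrite e (e origin) /=; lra.
Qed.

End Tree.

(* This property survives suspension and plays the role of alternation. *)
Definition two_valued_null (X : Type) n (c : seq X -> R) :=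
  forall u v s, size s = n -> every (fun x => x = u \/ x = v) s -> c s = 0.

(** * Boundedness of path sums *)

Section PathBound.
Variables (C : group) (n : nat) (c : seq C -> R) (M : R).
Hypothesis cM : forall s, size s = n.+1 -> `|c s| <= M.
Hypothesis c2 : two_valued_null n.+1 c.

Notation Z := (pt (letter C) (wreath C)).
Notation flip s := (flip (wreath C) s).
Implicit Types (p : option (letter C)) (z : Z) (zs : seq Z) (w : seq (letter C)).

(** [pathsum] with the points moved instead of the base vertex, which suits induction along the
    word. *)
Fixpoint psum w zs : R :=
  if w is s :: w' then c (map (phi (dir s)) zs) - psum w' (map (flip s : Z -> Z) zs) else 0.

Definition newrun p (s : letter C) := if p is Some p' then dir p' != dir s else true.
(** After the path has crossed [p'], a word starting with [p'] belongs to a point behind that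
    edge. *)
Definition departed p z := if p is Some p' then ohead (word z) == Some p' else false.

(* The number of subtrees met by the path to z1 onto which z projects differently from both
   ends of the path; p is the letter along which the path arrived. *)
Fixpoint bad w p z1 z : nat :=
  if w is s :: w' then
    ([&& newrun p s, ~~ departed p z & `[< phi (dir s) z <> phi (dir s) z1 >]] +
     bad w' (Some s) (flip s z1) (flip s z))%N
  else 0%N.

Definition extends p w := if p is Some p' then ohead w != Some p' else true.

Lemma extends_tail s w : reduced (s :: w) -> extends (Some s) w.
Proof. by case: w => [|a w] //= /andP[ne _]; apply: contra ne => /eqP[->]. Qed.

Lemma departed_flip s z : ohead (word z) != Some s -> departed (Some s) (flip s z).
Proof. by move=> /word_flip_neq /= ->; rewrite /= eqxx. Qed.

(** A path without backtracking never returns to the side of the edge on which [z] lies. *)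
Lemma bad_departed w p z1 z : reduced w -> extends p w -> departed p z -> bad w p z1 z = 0%N.
Proof.
elim: w p z1 z => [|s w IHw] [p|] z1 z //= red_w ext_w dep.
rewrite dep andbF /= IHw //; first exact: path_sorted red_w.
  exact: (extends_tail red_w).
apply: departed_flip; by move: dep ext_w => /eqP ->; rewrite eq_sym.
Qed.

Lemma bad_leaving s w p z1 z : reduced (s :: w) -> ohead (word z) != Some s -> (bad (s :: w) p z1 z <= 1)%N.
Proof.
move=> red_w ne /=; rewrite (bad_departed _ _ _ (departed_flip ne)) ?addn0 ?leq_b1 //.
  exact: path_sorted red_w.
exact: extends_tail red_w.
Qed.

(** If [z] followed the path out of the subtree of [p], both would project to the same exit letter.
    So [z] branches off at the latest where the path leaves this subtree, and only the branch vertex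
    can still count. *)
Lemma bad_le1 w (p : letter C) z1 z : reduced w -> word z1 = w -> phi (dir p) z <> phi (dir p) z1 ->
  (bad w (Some p) z1 z <= 1)%N.
Proof.
elim: w p z1 z => [|s w IHw] p z1 z // red_w wz1 nephi.
case: (eqVneq (ohead (word z)) (Some s)) => [hz|ne]; last exact: bad_leaving.
case: (eqVneq (dir s) (dir p)) => [sp|sp].
  rewrite /= sp eqxx /= add0n; apply: IHw; [exact: path_sorted red_w | exact: word_flip_cons |].
  by rewrite !phi_flip sp.
case: nephi; rewrite (phi_head wz1 sp).
by case: (word z) hz (@phi_head _ (dir p) z s) => [|a w'] //= [->] /(_ w') ->.
Qed.

(** One subtree may count while [z] still follows the path, and one more where it branches off. *)
Lemma bad_le2 w p z1 z : reduced w -> word z1 = w -> (bad w p z1 z <= 2)%N.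
Proof.
elim: w p z1 z => [|s w IHw] p z1 z // red_w wz1.
case: (eqVneq (ohead (word z)) (Some s)) => [hz|ne]; last by apply: leq_trans (bad_leaving _ _ _ ne) _.
have red_w' : reduced w by exact: path_sorted red_w.
have wz1' : word (flip s z1) = w by exact: word_flip_cons.
rewrite /=; case: asboolP => [nephi|_]; last by rewrite !andbF IHw.
have : (bad w (Some s) (flip s z1) (flip s z) <= 1)%N by apply: bad_le1; rewrite // !phi_flip.
by case: (_ && _) => /=; lia.
Qed.

Definition badsum w p z1 zs : nat := \sum_(z <- zs) bad w p z1 z.

Lemma badsum_cons s w p z1 zs : badsum (s :: w) p z1 zs =
  (\sum_(z <- zs) [&& newrun p s, ~~ departed p z & `[< phi (dir s) z <> phi (dir s) z1 >]] +
   badsum w (Some s) (flip s z1) (map (flip s : Z -> Z) zs))%N.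
Proof. by rewrite /badsum big_map -big_split. Qed.

Lemma badsum_le w p z1 zs : reduced w -> word z1 = w -> (badsum w p z1 zs <= 2 * size zs)%N.
Proof.
move=> red_w wz1; rewrite /badsum; elim: zs => [|z zs IHzs]; first by rewrite big_nil.
by rewrite big_cons /= mulnS leq_add // bad_le2.
Qed.

(** Along a run of edges in one direction the terms alternate in sign with a common value, so they
    add up to zero or one copy of it. [b] tells whether the run entered along [p] contributes a
    further copy. *)
Lemma psum_bound w p z1 zs : size zs = n -> reduced w -> word z1 = w -> extends p w ->
  exists b : bool, `|psum w (z1 :: zs) -
    (if p is Some p' then b%:R * c (map (phi (dir p')) (z1 :: zs)) else 0)| <= M * (badsum w p z1 zs)%:R.
Proof.
elim: w p z1 zs => [|s w IHw] p z1 zs szs red_w wz1 ext_w.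
  exists false; have -> : badsum [::] p z1 zs = 0%N by rewrite /badsum big1.
  rewrite mulr0 /=.
  by case: p {ext_w} => [p|]; rewrite ?mul0r subrr normr0.
have red_w' : reduced w by exact: path_sorted red_w.
have wz1' : word (flip s z1) = w by exact: word_flip_cons.
have szs' : size (map (flip s : Z -> Z) zs) = n by rewrite size_map.
have [b] := IHw (Some s) (flip s z1) (map (flip s : Z -> Z) zs) szs' red_w' wz1' (extends_tail red_w).
have phiE : map (phi (dir s)) (flip s z1 :: map (flip s : Z -> Z) zs) = map (phi (dir s)) (z1 :: zs).
  by rewrite -(map_cons (flip s : Z -> Z) z1) -map_comp; apply: eq_map => z /=; exact: phi_flip.
rewrite phiE badsum_cons.
set k := c (map (phi (dir s)) (z1 :: zs)); set S := psum w _.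
have -> : psum (s :: w) (z1 :: zs) = k - S by [].
set B := badsum w _ _ _ => bS.
have M0 : 0 <= M by apply: le_trans (cM _); last exact: (size_nseq n.+1 gone).
(* Inside an old run the new term has the same value as the previous one, so only the parity [b]
   flips. *)
case: (boolP (newrun p s)) => [new|old]; last first.
  rewrite big1_eq add0n; exists (~~ b).
  case: p {ext_w} old => [p|] //= /negPn/eqP ->; rewrite -/k.
  by rewrite (_ : _ - _ = - (S - b%:R * k)) ?normrN //; case: (b) => /=; ring.
exists false.
have -> : k - S - (if p is Some p' then false%:R * c (map (phi (dir p')) (z1 :: zs)) else 0) = k - S.
  by case: p {ext_w new} => [p|]; rewrite ?mul0r subr0.
case: (posnP (\sum_(z <- zs) [&& true, ~~ departed p z & `[< phi (dir s) z <> phi (dir s) z1 >]])) => [none|some].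
  (* Without bad points each projection equals that of [z1] or the point where the path entered the
     subtree, so two-valuedness applies. *)
  have k0 : k = 0.
    pose l := if p is Some p' then coor p' (dir s) else gone.
    apply: (c2 (u := phi (dir s) z1) (v := l)); first by rewrite /= size_map szs.
    split; first by left.
    apply: every_map; elim: zs none {szs szs' phiE k S B bS} => [|z zs IHzs] //.
    rewrite big_cons => /eqP; rewrite addn_eq0 => /andP[z0 /eqP/IHzs rest]; split=> //.
    move: z0; case: (boolP (departed p z)) => /= [dep _|_].
      right; rewrite /l; case: p dep new {IHzs rest ext_w l} => [p|] //=.
      by case wz : (word z) => [|a w'] //= /eqP[ea]; subst a; apply: phi_head wz.
    by case: asboolP => // /contrapT; left.
  rewrite none add0n; move: bS; rewrite k0 mulr0 subr0 => bS.
  by rewrite sub0r normrN.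
(* A bad point pays for the possible copy of [k], of size at most [M]. *)
apply: (@le_trans _ _ (M + M * B%:R)); last first.
  by rewrite natrD mulrDr lerD2r ler_peMr // ler1n.
case: (b) bS => /=; rewrite ?mul1r ?mul0r ?subr0 => bS.
  by rewrite distrC; apply: le_trans bS _; rewrite lerDr.
apply: le_trans (ler_normB _ _) _; apply: lerD => //.
by apply: cM; rewrite /= size_map szs.
Qed.

Lemma psum_le z1 zs : size zs = n -> `|psum (word z1) (z1 :: zs)| <= M * (2 * n)%:R.
Proof.
move=> szs; have [b] := psum_bound szs (word_red z1) erefl (isT : extends None _).
rewrite subr0 => /le_trans; apply; rewrite ler_wpM2l ?ler_nat //.
  by apply: le_trans (cM _); last exact: (size_nseq n.+1 gone).
by rewrite -szs badsum_le // word_red.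
Qed.

End PathBound.

Section Generated.
Variables (G : group) (D : G -> Prop).

Inductive generated : G -> Prop :=
| generated_in x : D x -> generated x
| generated1 : generated gone
| generatedM x y : generated x -> generated y -> generated (gmul x y)
| generatedV x : generated x -> generated (ginv x).

Lemma generated_subgroup : is_subgroup generated.
Proof. by split; [exact: generated1 | exact: generatedM | exact: generatedV]. Qed.

Lemma generated_countable (e : nat -> G) : (forall x, D x -> exists i, e i = x) ->
  countable_type (subgroup generated_subgroup).
Proof.
move=> eD.
pose letterval (p : nat * bool) := if p.2 then ginv (e p.1) else e p.1.
pose eval := foldr (fun p => gmul (letterval p)) gone.
have eval_cat l l' : eval (l ++ l') = gmul (eval l) (eval l').
  by elim: l => [|p l IHl] /=; rewrite ?gmul1 // IHl gmulA.
have evalP x : generated x -> exists l, eval l = x.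
  elim=> {x} [x /eD[i <-]||x y _ [l <-] _ [l' <-]|x _ [l <-]].
  - by exists [:: (i, false)]; rewrite /= gmulr1.
  - by exists [::].
  - by exists (l ++ l').
  exists (rev [seq (p.1, ~~ p.2) | p <- l]).
  elim: l => [|[i b] l IHl] /=; first by rewrite ginv1.
  rewrite rev_cons -cats1 eval_cat IHl ginvM /= gmulr1; congr gmul.
  by rewrite /letterval /=; case: b => //=; rewrite ginvK.
have /choice[code codeP] : forall x : subgroup generated_subgroup, exists l, eval l = sval x.
  by move=> x; apply: evalP; case: x.
exists (fun x => pickle (code x)) => x y /(pcan_inj pickleK) exy.
have : sval x = sval y by rewrite -!codeP exy.
by case: x {codeP exy} => x gx; case: y => y gy /= exy; exact: eq_exist.
Qed.

End Generated.

Lemma lamp_countable (C : group) : countable_type C -> countable_type (lamp C).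
Proof.
move=> [c cinj].
have /choice[m mP] : forall x : lamp C, exists m, wr_supp m (sval x) by case.
pose code (x : lamp C) := [seq (c (wfun (sval x) i), wperm (sval x) i) | i <- iota 0 (m x)].
exists (fun x => pickle (code x)) => x y /(pcan_inj pickleK) exy; apply: lamp_ext.
have mxy : m x = m y by have := congr1 size exy; rewrite !size_map !size_iota.
have eq_lt i : (i < m x)%N -> (c (wfun (sval x) i), wperm (sval x) i) = (c (wfun (sval y) i), wperm (sval y) i).
  move=> lti; have := congr1 (fun s => nth (0%N, 0%N) s i) exy.
  by rewrite !(nth_map 0%N) ?size_iota -?mxy // nth_iota.
apply: wr_ext => i; case: (ltnP i (m x)) => [lti|lei].
- by have [/cinj] := eq_lt i lti.
- by rewrite (mP x i lei).1 (mP y i _).1 // -mxy.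
- by have [_] := eq_lt i lti.
- by rewrite (mP x i lei).2 (mP y i _).2 // -mxy.
Qed.

(** * The suspended cocycle *)

Section Suspension.
Variable C : group.
Notation Z := (pt (letter C) (wreath C)).
Notation P := (bij_group Z).

Definition base_letter : letter C := (0%N, fun=> gone).
Definition base_flip : P := flip (wreath C) base_letter.

Definition sus_gen (g : P) : Prop := exists a : lamp C,
  g = mv (sval a) \/ g = gmul base_flip (gmul (mv (sval a)) base_flip).

(* Generated by two copies of lamp C that share the copy of C at position 0. *)
Definition sus_group := subgroup (generated_subgroup sus_gen).

Lemma sus_countable : countable_type C -> countable_type sus_group.
Proof.
move=> /lamp_countable Lc; have [e eP] := countable_enum (gone : lamp C) Lc.
apply: (generated_countable (e := fun i => if odd i then mv (sval (e i./2)) else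
  gmul base_flip (gmul (mv (sval (e i./2))) base_flip))) => x [a [->|->]]; have [i <-] := eP a.
  by exists i.*2.+1; rewrite /= odd_double /= uphalf_double.
by exists i.*2; rewrite odd_double half_double.
Qed.

(** Each generator contains an even number of flips, so the signs cancel. *)
Lemma sus_additive (g : P) : generated sus_gen g -> additive_at 1 g.
Proof.
elim=> {g} [g [a [->|->]]||g h _ ga _ ha|g _ ga].
- exact: additive_mv.
- have := additive_mul (additive_flip base_letter) (additive_mul (additive_mv (sval a)) (additive_flip base_letter)).
  by rewrite mul1r mulrNN mulr1.
- exact: additive_one.
- by have := additive_mul ga ha; rewrite mulr1.
- exact: additive_inv.
Qed.

Variables (n : nat) (c : seq C -> R).
Hypotheses (c_coc : bcocyc n.+1 c) (c2 : two_valued_null n.+1 c).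

Definition orbpt (y : P) : Z := y (origin C).

(** The value of [c] on the projections of [ys] to the subtree of direction [i] at [v]. By
    [sus_class] it depends only on that subtree, the change of coordinates being absorbed by
    invariance of [c]. *)
Definition sus_fun (ys : seq P) : P -> nat -> R :=
  fun v i => c [seq phi i (orbpt (gmul (ginv v) y)) | y <- ys].

Definition sus (s : seq P) : R :=
  if s is y0 :: ys then
    if ys is y1 :: _ then pathsum (word (orbpt (gmul (ginv y0) y1))) (shift y0 (sus_fun ys)) else 0
  else 0.

Lemma sus_class ys : size ys = n.+1 -> class_fun (sus_fun ys).
Proof.
move=> szy; split=> [v s|v b i]; rewrite /sus_fun.
  by congr c; apply: eq_map => y; rewrite (ginvM v) flipV -gmulA; exact: phi_flip.
have [[_ cinv] _] := c_coc.
rewrite -[RHS](cinv (wfun (ginv b) i)) ?size_map // -map_comp; congr c; apply: eq_map => y.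
by rewrite (ginvM v) -(homV b (@mvM C)) -gmulA; exact: phi_mv.
Qed.

Lemma sus_inv g s : sus (map (gmul g) s) = sus s.
Proof.
case: s => [|y0 [|y1 s]] //.
have e y z : gmul (ginv (gmul g y)) (gmul g z) = gmul (ginv y) z by rewrite (ginvM g) -gmulA gmulKV.
rewrite [LHS](_ : _ = pathsum (word (orbpt (gmul (ginv (gmul g y0)) (gmul g y1))))
  (shift (gmul g y0) (sus_fun (map (gmul g) (y1 :: s))))) // e.
congr pathsum; apply/funext => v; apply/funext => i.
rewrite /shift /sus_fun -map_comp; congr c; apply: eq_map => y.
by rewrite /comp -(gmulA g y0 v) e.
Qed.

Lemma ds_pathsum (T : Type) w (K : seq T -> P -> nat -> R) s :
  ds (fun t => pathsum w (K t)) s = pathsum w (fun v i => ds (fun t => K t v i) s).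
Proof.
elim: w K => [|a w IHw] K /=; first exact: ds0.
by rewrite dsB (IHw (fun t => shift _ (K t))).
Qed.

(** The cocycle identity for [c] removes [y1] from the coefficients while the path stays fixed. *)
Lemma sus_cons_ds y0 y1 ys : size ys = n.+1 ->
  ds (fun t => sus (y0 :: y1 :: t)) ys =
  pathsum (word (orbpt (gmul (ginv y0) y1))) (shift y0 (sus_fun ys)).
Proof.
move=> szy; have [_ c0] := c_coc.
rewrite (ds_pathsum _ (fun t => shift y0 (sus_fun (y1 :: t)))); congr pathsum.
apply/funext => v; apply/funext => i; rewrite /shift /sus_fun.
set E := fun y => phi i (orbpt (gmul (ginv (gmul y0 v)) y)).
have := c0 (map E (y1 :: ys)); rewrite size_map /= szy => /(_ erefl).
by rewrite (ds_map E (fun t => c (E y1 :: t))); lra.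
Qed.

(** After [sus_cons_ds] the identity says that the path sum from [y0] to [y2] splits at [y1]. This
    is additivity with sign 1, available in the generated subgroup. *)
Lemma sus_cocycle s : size s = n.+3 -> every (generated sus_gen) s -> ds sus s = 0.
Proof.
case: s => [|y0 [|y1 [|y2 ys]]] //= [szy] [g0 [g1 [g2 _]]].
have := @sus_cons_ds y0 y1 (y2 :: ys); rewrite /= szy => /(_ erefl) ->.
have sz2 : size (y2 :: ys) = n.+1 by rewrite /= szy.
have ga : additive_at 1 (gmul (ginv y0) y1).
  by apply: sus_additive; apply: generatedM => //; exact: generatedV.
have := ga (orbpt (gmul (ginv y1) y2)) _ (class_shift y0 (sus_class sz2)).
rewrite shiftM gmulKr mul1r -[bfun _ (orbpt _)]/(orbpt (gmul (gmul (ginv y0) y1) (gmul (ginv y1) y2))).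
by rewrite -gmulA gmulKr -[bfun _ (origin C)]/(orbpt _) => ->; lra.
Qed.

Lemma sus_bounded : exists M : R, forall s, size s = n.+2 -> `|sus s| <= M.
Proof.
have [[[M cM] _] _] := c_coc.
(* Each of the [n] points after [y1] is bad in at most two subtrees. *)
exists (M * (2 * n)%:R) => -[|y0 [|y1 ys]] //= [szy].
pose z y := orbpt (gmul (ginv y0) y).
suff -> : pathsum (word (z y1)) (shift y0 (sus_fun (y1 :: ys))) = psum c (word (z y1)) (map z (y1 :: ys)).
  by apply: psum_le; rewrite ?size_map.
have -> : shift y0 (sus_fun (y1 :: ys)) =
    (fun v i => c [seq phi i (bfun (ginv v) x) | x <- map z (y1 :: ys)]).
  apply/funext => v; apply/funext => i; rewrite /shift /sus_fun -map_comp; congr c.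
elim: (word _) (map z _) => [|s w IHw] zs //=.
rewrite -IHw; congr (_ - _); congr pathsum.
by apply/funext => v; apply/funext => i; rewrite /shift -map_comp; congr c.
Qed.

Lemma sus_two_valued : two_valued_null n.+2 sus.
Proof.
move=> u v [|y0 [|y1 ys]] //= [szy] [_ ev]; have {}ev : every (fun y => y = u \/ y = v) (y1 :: ys) by [].
set w := word _; set K := shift _ _.
have -> : K = fun _ _ => 0.
  apply/funext => x; apply/funext => i; rewrite /K /shift /sus_fun.
  set E := fun y => phi i (orbpt (gmul (ginv (gmul y0 x)) y)).
  apply: (c2 (u := E u) (v := E v)); first by rewrite size_map /= szy.
  by apply: every_map; apply: every_impl ev => y [->|->]; [left | right].
by elim: w => [|a w IHw] //=; rewrite [shift _ _](_ : _ = fun _ _ => 0) // IHw subrr.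
Qed.

Definition sus_class_cocycle (s : seq sus_group) : R := sus (map sval s).

Lemma sus_bcocyc : bcocyc n.+2 sus_class_cocycle.
Proof.
split; [split|].
- by have [M sM] := sus_bounded; exists M => s sz; apply: sM; rewrite size_map.
- move=> g s sz; rewrite /sus_class_cocycle -[RHS](sus_inv (sval g)) -!map_comp.
  by congr sus; apply: eq_map.
- move=> s sz; rewrite /sus_class_cocycle -(ds_map sval sus) sus_cocycle ?size_map //.
  by apply: every_map; elim: (s) => [|[g gg] s' IHs].
Qed.

Lemma sus_class_two_valued : two_valued_null n.+2 sus_class_cocycle.
Proof.
move=> u v s sz ev; apply: (sus_two_valued (u := sval u) (v := sval v)); first by rewrite size_map.
by apply: every_map; apply: every_impl ev => x [->|->]; [left | right].
Qed.

End Suspension.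

(** * Nontriviality of the suspended class *)

Section SuspensionNontrivial.
Variables (C : group) (n : nat) (c : seq C -> R).
Hypothesis C_countable : countable_type C.
Hypothesis c_coc : bcocyc n.+2 c.

Notation t := (base_flip C).
Notation P := (bij_group (pt (letter C) (wreath C))).

Lemma sus_in0 (a : lamp C) : generated (@sus_gen C) (mv (sval a)).
Proof. by apply: generated_in; exists a; left. Qed.

Lemma sus_in1 (a : lamp C) : generated (@sus_gen C) (gmul t (gmul (mv (sval a)) t)).
Proof. by apply: generated_in; exists a; right. Qed.

Definition sus_emb0 (a : lamp C) : sus_group C := exist _ _ (sus_in0 a).
Definition sus_emb1 (a : lamp C) : sus_group C := exist _ _ (sus_in1 a).

Lemma sus_emb0M : is_hom sus_emb0.
Proof. by move=> a b; apply: eq_exist; exact: mvM. Qed.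

Lemma sus_emb1M : is_hom sus_emb1.
Proof.
move=> a b; apply: eq_exist.
transitivity (gmul t (gmul (gmul (mv (sval a)) (mv (sval b))) t)); first by rewrite -(mvM (sval a) (sval b)).
transitivity (gmul (gmul t (gmul (mv (sval a)) t)) (gmul t (gmul (mv (sval b)) t))); last by [].
by rewrite -!gmulA (gmulA t t) flip2 gmul1.
Qed.

(** The first copy fixes the root vertex, so all paths are empty. *)
Lemma sus_emb0_null s : size s = n.+3 -> sus c (map (fun a : lamp C => mv (sval a)) s) = 0.
Proof.
by case: s => [|a0 [|a1 s]].
Qed.

Definition tw (a : lamp C) : P := gmul (mv (sval a)) t.

Lemma sus_emb1_eq s : sus c (map (sval \o sus_emb1) s) = sus c (map tw s).
Proof. by rewrite -[RHS](sus_inv c t) -map_comp. Qed.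

Lemma sus_fun_tw ys v a : size ys = n.+2 ->
  sus_fun c ys (gmul v (mv a)) 0%N = sus_fun c ys v (wperm a 0%N).
Proof. by move=> sz; rewrite (sus_class c_coc sz).2. Qed.

(** Up to sign, a bounded primitive of the restriction to the second copy: [c] on the projections to
    the subtree at the root in the direction singled out by the first argument. *)
Definition sus_aux (s : seq (lamp C)) : R :=
  if s is a :: _ then sus_fun c (map tw s) gone (wperm (sval a) 0%N) else 0.

(** The path is made of a flip, a move and a flip, so its sum is a difference of two values of
    [sus_fun] at the root. The cocycle identity for [c] recognises this as a coboundary. *)
Lemma sus_tw s : size s = n.+3 -> sus c (map tw s) = - ds sus_aux s.
Proof.
case: s => [|a0 [|a1 s]] // [sz].
have szy : size (map tw (a1 :: s)) = n.+2 by rewrite /= size_map sz.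
have Kc := sus_class c_coc szy.
pose K := shift (tw a0) (sus_fun c (map tw (a1 :: s))).
have Kc' : class_fun K by exact: class_shift.
have pathE : pathsum (word (orbpt (gmul (ginv (tw a0)) (tw a1)))) K =
    sus_fun c (map tw (a1 :: s)) gone (wperm (sval a0) 0%N) -
    sus_fun c (map tw (a1 :: s)) gone (wperm (sval a1) 0%N).
  have -> : gmul (ginv (tw a0)) (tw a1) = gmul t (gmul (mv (gmul (ginv (sval a0)) (sval a1))) t).
    rewrite /tw (ginvM (mv (sval a0))) flipV -(homV (sval a0) (@mvM C)) (mvM (ginv (sval a0)) (sval a1)).
    by rewrite -!gmulA.
  set b := gmul (ginv _) _.
  rewrite -[orbpt _]/(bfun t (bfun (mv b) (bfun t (origin C)))) pathsum_flip // pathsum_mv; last exact: class_shift.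
  rewrite pathsum_flip; last by do 2! apply: class_shift.
  rewrite /= subr0 /K !shiftM /shift gmulr1 !gmulr1; congr (_ - _).
    have [K1 _] := Kc; rewrite /tw (K1 _ (base_letter C)) -[mv _]gmul1.
    exact: sus_fun_tw.
  rewrite -!gmulA (gmulA t t) flip2 gmul1 -(mvM (sval a0) b) /b gmulKr -[mv _]gmul1.
  exact: sus_fun_tw.
rewrite [LHS]pathE.
have -> : ds sus_aux (a0 :: a1 :: s) = sus_aux (a1 :: s) - ds (fun u => sus_aux (a0 :: u)) (a1 :: s) by [].
have [_ c0] := c_coc.
suff -> : ds (fun u => sus_aux (a0 :: u)) (a1 :: s) =
    sus_fun c (map tw (a1 :: s)) gone (wperm (sval a0) 0%N).
  by rewrite /sus_aux; lra.
pose E y := phi (wperm (sval a0) 0%N) (orbpt (gmul (ginv gone) (tw y))).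
have e u : sus_fun c (map tw u) gone (wperm (sval a0) 0%N) = c (map E u).
  by rewrite /sus_fun -map_comp.
rewrite e (@ext_ds _ _ (fun u => c (E a0 :: map E u))) => [|u]; last exact: e.
have := c0 (map E (a0 :: a1 :: s)); rewrite size_map /= sz => /(_ erefl).
by rewrite !ds_map; lra.
Qed.

Lemma sus_aux_bcoch : bcoch n.+2 sus_aux.
Proof.
have [[[M cM] cinv] _] := c_coc.
split; first by exists M => -[|a s] // sz; rewrite /sus_aux /sus_fun cM // !size_map.
move=> g [|a s] // sz; set i := wperm (sval a) 0%N.
transitivity (sus_fun c (map tw (map (gmul g) (a :: s))) gone (wperm (sval g) i)); first by [].
transitivity (sus_fun c (map tw (a :: s)) gone i); last by [].
move: (a :: s) sz => r sz; rewrite /sus_fun.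
rewrite -[RHS](cinv (wfun (sval g) (wperm (sval g) i))) ?size_map // -!map_comp.
congr c; apply: eq_map => b; rewrite /comp.
have -> : orbpt (gmul (ginv gone) (tw (gmul g b))) = mv (sval g) (orbpt (gmul (ginv gone) (tw b))).
  rewrite !ginv1 !gmul1 /tw -[sval (gmul g b)]/(gmul (sval g) (sval b)) (mvM (sval g) (sval b)).
  by rewrite -gmulA.
by rewrite phi_mv bfunK.
Qed.

Definition lamp_coor0 (x : C) : wreath C := Wr (fun i => if i == 0%N then x else gone) (bone nat).

Lemma lamp_coor0_supp x : exists m, wr_supp m (lamp_coor0 x).
Proof. by exists 1%N => -[|i]. Qed.

Definition lamp_emb (x : C) : lamp C := exist _ _ (lamp_coor0_supp x).

Lemma lamp_embM : is_hom lamp_emb.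
Proof.
move=> x y; apply: eq_exist; apply: wr_ext => i //=.
by case: eqP => // _; rewrite gmul1.
Qed.

Lemma act_base x : act (lamp_coor0 x) (base_letter C) = base_letter C.
Proof.
rewrite /act /base_letter /dir /coor /=; congr pair; apply/funext => j.
by case: eqP => // _; rewrite gmul1.
Qed.

(** The base letter is a line in direction 0, so changing coordinate 0 fixes it and commutes with
    its flip. *)
Lemma sus_emb_amalgam x : sus_emb1 (lamp_emb x) = sus_emb0 (lamp_emb x).
Proof.
apply: eq_exist; transitivity (gmul t (gmul (mv (lamp_coor0 x)) t)); first by [].
by rewrite mv_flip act_base gmulA flip2 gmul1.
Qed.

Lemma sus_aux_emb s : size s = n.+2 -> sus_aux (map lamp_emb s) = c s.
Proof.
case: s => [|x s] // _; rewrite /sus_aux [map lamp_emb _]/= /sus_fun.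
rewrite -[RHS](congr1 c (map_id _)) -(map_cons lamp_emb) -!map_comp; congr c; apply: eq_map => y.
rewrite /comp /phi /orbpt /tw ginv1 gmul1 /=; exact: gmulr1.
Qed.

Lemma sus_nontrivial : bcobd n.+2 (sus_class_cocycle c) -> bcobd n.+1 c.
Proof.
have /boundedly_acyclicP ba := lamp_acyclic C_countable.
move=> [h hb hE].
have emb0E s : map sval (map sus_emb0 s) = map (fun a : lamp C => mv (sval a)) s by rewrite -map_comp.
have emb1E s : map sval (map sus_emb1 s) = map (sval \o sus_emb1) s by rewrite -map_comp.
(* On the first copy the suspension vanishes, so [h] is a cocycle there and acyclicity gives a
   primitive. *)
have [u0 u0b u0E] : bcobd n.+1 (fun s => h (map sus_emb0 s)).
  apply: ba; split; first exact: (bcoch_map sus_emb0M hb).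
  move=> s sz; rewrite -ds_map -hE ?size_map // /sus_class_cocycle emb0E; exact: sus_emb0_null.
(* On the second copy [h] becomes a cocycle after correction by [sus_aux]. *)
have [u1 u1b u1E] : bcobd n.+1 (fun s => h (map sus_emb1 s) + sus_aux s).
  apply: ba; split; first exact: (bcochD (bcoch_map sus_emb1M hb) sus_aux_bcoch).
  move=> s sz; rewrite dsD -ds_map -hE ?size_map // /sus_class_cocycle emb1E sus_emb1_eq sus_tw //; lra.
(* On [C] the two embeddings agree, so [h] cancels in the difference and [sus_aux] restricts to
   [c]. *)
exists (fun s => u1 (map lamp_emb s) - u0 (map lamp_emb s)).
  by apply: bcochB; exact: (bcoch_map lamp_embM).
move=> s sz; rewrite dsB -!ds_map -u1E ?size_map // -u0E ?size_map // sus_aux_emb //.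
have -> : map sus_emb1 (map lamp_emb s) = map sus_emb0 (map lamp_emb s).
  by rewrite -!map_comp; apply: eq_map => x; exact: sus_emb_amalgam.
lra.
Qed.

End SuspensionNontrivial.

(** * A nontrivial class in degree 2 *)

Section Base.

Notation Z := (pt nat unit).
Notation P := (bij_group Z).
Notation fl s := (flip unit (s : nat)).
Implicit Types (w r u : seq nat) (a b s : nat).

Definition lam a b : R := (b == a.+1)%:R - (a == b.+1)%:R.

Lemma lamN a b : lam b a = - lam a b.
Proof. by rewrite /lam opprB. Qed.

Lemma lam_le1 a b : `|lam a b| <= 1.
Proof. by rewrite /lam; case: (_ == _); case: (_ == _); rewrite ler_norml /=; lra. Qed.

(** A counting quasimorphism: steps up by one minus steps down by one between adjacent letters.
    Antisymmetry of [lam] makes it odd under inversion. *)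
Fixpoint psi w : R := if w is a :: w' then (if w' is b :: _ then lam a b else 0) + psi w' else 0.

Lemma psi_cons2 a b w : psi [:: a, b & w] = lam a b + psi (b :: w).
Proof. by []. Qed.

Lemma psi_catrev s r w : psi (catrev r (s :: w)) = psi (s :: w) - psi (s :: r).
Proof.
elim: r s w => [|a r IHr] s w; first by rewrite /=; lra.
by rewrite [catrev _ _]/= IHr !psi_cons2 lamN; lra.
Qed.

Lemma psi_rev w : psi (rev w) = - psi w.
Proof. by case: w => [|a w]; rewrite /rev ?[catrev _ _]/= ?psi_catrev /=; lra. Qed.

(** The reduced form of [rev r ++ w] for reduced [r] and [w], computed by cancelling at the
    junction. *)
Fixpoint cancels r w : seq nat := if r is s :: r' then cancels r' (toggle s w) else w.

Lemma cancels_catrev s r w : reduced (s :: r) -> cancels r (s :: w) = catrev r (s :: w).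
Proof.
elim: r s w => [|a r IHr] s w //= /andP[ne red_r].
by rewrite (negbTE ne) IHr.
Qed.

Lemma foldr_toggle r w : foldr (@toggle _) w (rev r) = cancels r w.
Proof. by elim: r w => [|s r IHr] w //=; rewrite rev_cons foldr_rcons IHr. Qed.

Lemma psi_cancels_neq r w : reduced r -> (if r is s :: _ then ohead w != Some s else true) ->
  `|psi (cancels r w) + psi r - psi w| <= 1.
Proof.
case: r => [|s r] red_r ne; first by rewrite addr0 subrr normr0.
have -> : cancels (s :: r) w = catrev r (s :: w).
  rewrite -cancels_catrev //; case: w ne => [|a w] //= ne.
  by rewrite ifN //; apply: contra ne => /eqP->.
rewrite psi_catrev subrK.
by case: w {ne} => [|a w] /=; [rewrite addr0 subrr normr0 | rewrite addrK lam_le1].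
Qed.

(** A common prefix of [r] and [w] cancels and contributes equally to both. Only three adjacent
    pairs are affected where they diverge: one lost from each word and one created. *)
Lemma psi_cancels r w : reduced r -> reduced w -> `|psi (cancels r w) + psi r - psi w| <= 3.
Proof.
elim: r w => [|s r IHr] w red_r red_w; first by rewrite addr0 subrr normr0.
case: (eqVneq (ohead w) (Some s)) => [|ne]; last first.
  by apply: le_trans (psi_cancels_neq red_r ne) _; lra.
case: w red_w => [|a w] // red_w [ea]; subst a.
have red_r' : reduced r by exact: path_sorted red_r.
have red_w' : reduced w by exact: path_sorted red_w.
have -> : cancels (s :: r) (s :: w) = cancels r w by rewrite /= eqxx.
have [eh|ne] := eqVneq (ohead r) (ohead w).
  have := IHr w red_r' red_w'; congr (`|_| <= _).
  by case: r w eh {IHr red_r red_w red_r' red_w'} => [|a r] [|b w] //= eh; [lra | case: eh => ->; lra].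
have h1 : `|psi (cancels r w) + psi r - psi w| <= 1.
  by apply: psi_cancels_neq => //; case: (r) ne => // a r'; rewrite eq_sym.
have b1 v : `|psi (s :: v) - psi v| <= 1.
  by case: v => [|a v]; rewrite /=; [rewrite addr0 subrr normr0 | rewrite addrK lam_le1].
have := b1 r; have := b1 w; move: h1; rewrite !ler_norml; lra.
Qed.

Fixpoint flips w : P := if w is s :: w' then gmul (fl s) (flips w') else gone.

Lemma flips_cons s w : flips (s :: w) = gmul (fl s) (flips w). Proof. by []. Qed.

Definition base_origin : Z := @Pt nat unit [::] tt isT.

Definition base_gen (g : P) := exists s, g = fl s.
Definition base_group := subgroup (generated_subgroup base_gen).

Lemma base_countable : countable_type base_group.
Proof. by apply: (generated_countable (e := fun s => fl s)) => g [s ->]; exists s. Qed.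

Lemma flips_cat w w' : flips (w ++ w') = gmul (flips w) (flips w').
Proof. by elim: w => [|s w IHw]; rewrite ?gmul1 // cat_cons !flips_cons IHw gmulA. Qed.

Lemma flips_rev w : flips (rev w) = ginv (flips w).
Proof.
elim: w => [|s w IHw]; first by rewrite ginv1.
by rewrite rev_cons -cats1 flips_cat IHw !flips_cons (ginvM (fl s)) flipV gmulr1.
Qed.

Lemma generated_flips g : generated base_gen g -> exists w, g = flips w.
Proof.
elim=> {g} [g [s ->]||g h _ [w ->] _ [w' ->]|g _ [w ->]].
- by exists [:: s]; rewrite flips_cons gmulr1.
- by exists [::].
- by exists (w ++ w'); rewrite flips_cat.
- by exists (rev w); rewrite flips_rev.
Qed.

Lemma flips_toggle s w : flips (toggle s w) = gmul (fl s) (flips w).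
Proof.
case: w => [|a w] //; rewrite [toggle _ _]/= flips_cons; case: eqVneq => [->|_] //.
by rewrite gmulA flip2 gmul1.
Qed.

Definition wd (g : P) : seq nat := word (g base_origin).

Lemma wd_flips w : wd (flips w) = foldr (@toggle _) [::] w.
Proof. by elim: w => [|s w IHw] //; rewrite /= -IHw. Qed.

Lemma flips_wd g : generated base_gen g -> g = flips (wd g).
Proof.
move=> /generated_flips[w ->]; rewrite wd_flips.
by elim: w => [|s w IHw] //=; rewrite flips_toggle -IHw.
Qed.

Lemma wd_mul g h : generated base_gen g -> wd (gmul g h) = cancels (rev (wd g)) (wd h).
Proof.
move=> /flips_wd {1}->; rewrite -foldr_toggle revK.
by elim: (wd g) => [|s w IHw] //=; rewrite -IHw.
Qed.

Lemma wd_inv g : generated base_gen g -> wd (ginv g) = rev (wd g).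
Proof.
move=> /flips_wd {1}->; rewrite -flips_rev wd_flips foldr_toggle.
have := word_red (g base_origin); rewrite -/(wd g).
by case: (wd g) => [|s w] // red_w; rewrite /= cancels_catrev.
Qed.

Lemma psi_defect g h : generated base_gen g ->
  `|psi (wd (gmul g h)) - psi (wd g) - psi (wd h)| <= 3.
Proof.
move=> gg; rewrite wd_mul //.
have := @psi_cancels (rev (wd g)) (wd h).
rewrite psi_rev; apply; last exact: word_red.
rewrite -wd_inv //; exact: word_red.
Qed.

Definition base_phi (s : seq base_group) : R :=
  if s is [:: x; y] then psi (wd (sval (gmul (ginv x) y))) else 0.

Definition base_class : seq base_group -> R := ds base_phi.

Lemma base_classE x y z : base_class [:: x; y; z] =
  psi (wd (sval (gmul (ginv y) z))) - psi (wd (sval (gmul (ginv x) z))) + psi (wd (sval (gmul (ginv x) y))).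
Proof. by rewrite /base_class /=; lra. Qed.

Lemma psi_wdV (x : base_group) : psi (wd (sval (ginv x))) = - psi (wd (sval x)).
Proof. by rewrite -psi_rev -wd_inv //; case: x. Qed.

Lemma base_bcocyc : bcocyc 3 base_class.
Proof.
split; last by move=> s _; exact: ds_ds.
split.
  exists 3 => -[|x [|y [|z [|]]]] // _; rewrite base_classE.
  have := @psi_defect (sval (gmul (ginv x) y)) (sval (gmul (ginv y) z)) (svalP (gmul (ginv x) y)).
  have -> : gmul (sval (gmul (ginv x) y)) (sval (gmul (ginv y) z)) = sval (gmul (ginv x) z).
    by rewrite -[LHS]/(sval (gmul (gmul (ginv x) y) (gmul (ginv y) z))) -gmulA gmulKr.
  by rewrite !ler_norml; lra.
move=> g [|x [|y [|z [|]]]] // _; rewrite [map _ _]/= !base_classE.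
have e (p q : base_group) : gmul (ginv (gmul g p)) (gmul g q) = gmul (ginv p) q.
  by rewrite (ginvM g) -gmulA gmulKV.
by rewrite !e.
Qed.

(** Three entries with two values contain a repetition, and oddness of [psi] under inversion makes
    the coboundary vanish at a repetition. *)
Lemma base_two_valued : two_valued_null 3 base_class.
Proof.
have psi1 : psi (wd gone) = 0 by [].
have xx (x : base_group) : psi (wd (sval (gmul (ginv x) x))) = 0 by rewrite gmulV.
have xyx (x y : base_group) : psi (wd (sval (gmul (ginv y) x))) = - psi (wd (sval (gmul (ginv x) y))).
  by rewrite -psi_wdV ginvM ginvK.
move=> u v [|x [|y [|z [|]]]] // _ [] + [] + [] + _.
by move=> [] -> [] -> [] ->; rewrite base_classE !xx ?(xyx u v); lra.
Qed.

Lemma base_nontrivial : ~ bcobd 2 base_class.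
Proof.
move=> [h [[M hM] hinv] hE].
have fl_gen s : generated base_gen (fl s) by apply: generated_in; exists s.
pose fg s : base_group := exist _ _ (fl_gen s).
(* With a bounded primitive [h], the difference [eta] is a homomorphism. It vanishes on the
   generators, which are involutions, hence on all products of generators, so [psi] would be bounded
   there by [M]. *)
pose eta (x : base_group) := psi (wd (sval x)) - h [:: gone; x].
have ds3 (p q z : base_group) : ds h [:: p; q; z] = h [:: q; z] - h [:: p; z] + h [:: p; q] by rewrite /=; lra.
have etaM x y : eta (gmul x y) = eta x + eta y.
  have := hE [:: gone; x; gmul x y] erefl; rewrite base_classE ds3 ginv1 !gmul1 gmulKV.
  have := hinv x [:: gone; y] erefl; rewrite [map _ _](_ : _ = [:: gmul x gone; gmul x y]) // gmulr1 /eta; lra.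
have eta1 : eta gone = 0 by have := etaM gone gone; rewrite gmul1; lra.
have eta_fl s : eta (fg s) = 0.
  have := etaM (fg s) (fg s).
  have -> : gmul (fg s) (fg s) = gone by apply: eq_exist; exact: flip2.
  by rewrite eta1; lra.
pose prod := foldr (fun s => gmul (fg s)) gone.
have eta_prod w : eta (prod w) = 0.
  by elim: w => [|s w IHw] //=; rewrite etaM eta_fl IHw addr0.
have prodE w : sval (prod w) = flips w by elim: w => [|s w IHw] //=; rewrite -IHw.
have red_iota k a : reduced (iota a k).
  by elim: k a => [|[|k] IHk] a //; rewrite /reduced /= (ltn_eqF (ltnSn a)); exact: IHk.
have wd_iota k a : wd (flips (iota a k)) = iota a k.
  elim: k a => [|k IHk] a //.
  rewrite wd_flips [foldr _ _ _]/= -wd_flips IHk.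
  by case: k {IHk} => [|k] //=; rewrite gtn_eqF.
have psi_iota k a : psi (iota a k.+1) = k%:R.
  elim: k a => [|k IHk] a; first by rewrite /= addr0.
  rewrite [iota _ _]/= psi_cons2 -[_ :: _]/(iota a.+1 k.+1) IHk /lam eqxx.
  by rewrite (ltn_eqF (leqnSn a.+1)) -natr1 subr0 addrC.
(* The increasing word of length [k + 1] has [psi] equal to [k], which exceeds [M]. *)
pose k := (Num.Def.truncn M).+1.
have ltM : M < k%:R by rewrite truncnS_gt.
have := hM [:: gone; prod (iota 0 k.+1)] erefl.
have := eta_prod (iota 0 k.+1); rewrite /eta prodE wd_iota psi_iota => /eqP.
by rewrite subr_eq0 => /eqP <-; rewrite ger0_norm ?ler0n // leNgt ltM.
Qed.

End Base.

(** * The dimension of the bounded cohomology of H *)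

Section RestrictedProduct.
Variable F : nat -> group.

Definition dp_mul (x y : forall i, F i) : forall i, F i := fun i => gmul (x i) (y i).
Definition dp_inv (x : forall i, F i) : forall i, F i := fun i => ginv (x i).
Definition dp_one : forall i, F i := fun i => gone.

Lemma dp_mulA x y z : dp_mul x (dp_mul y z) = dp_mul (dp_mul x y) z.
Proof. by apply: functional_extensionality_dep => i; exact: gmulA. Qed.
Lemma dp_mul1 x : dp_mul dp_one x = x.
Proof. by apply: functional_extensionality_dep => i; exact: gmul1. Qed.
Lemma dp_mulV x : dp_mul (dp_inv x) x = dp_one.
Proof. by apply: functional_extensionality_dep => i; exact: gmulV. Qed.

Definition dprod := Defs.Group dp_mulA dp_mul1 dp_mulV.

Definition dp_supp m (x : dprod) := forall i, (m <= i)%N -> x i = gone.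

Lemma rprod_subgroup : is_subgroup (fun x : dprod => exists m, dp_supp m x).
Proof.
split; first by exists 0%N.
  move=> x y [m sx] [m' sy]; exists (maxn m m') => i; rewrite geq_max => /andP[le1 le2] /=.
  by rewrite /dp_mul sx // sy // gmul1.
by move=> x [m sx]; exists m => i lei /=; rewrite /dp_inv sx // ginv1.
Qed.

Definition rprod := subgroup rprod_subgroup.

Definition proj i (x : rprod) : F i := sval x i.

Definition single_fun i (x : F i) : forall j, F j :=
  fun j => if i =P j is ReflectT e then ecast k (F k) e x else gone.

Lemma single_supp i x : exists m, dp_supp m (@single_fun i x).
Proof. by exists i.+1 => j ltj; rewrite /single_fun; case: eqP => // e; rewrite e ltnn in ltj. Qed.

Definition single i (x : F i) : rprod := exist _ _ (single_supp x).

Lemma single_same i (x : F i) : proj i (single x) = x.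
Proof. by rewrite /proj /= /single_fun; case: eqP => // e; rewrite eq_axiomK. Qed.

Lemma single_other i j (x : F i) : j != i -> proj j (single x) = gone.
Proof. by move=> ne; rewrite /proj /= /single_fun; case: eqP => // e; rewrite e eqxx in ne. Qed.

Lemma single_hom i : is_hom (@single i).
Proof.
move=> x y; apply: eq_exist; apply: functional_extensionality_dep => j /=.
rewrite /dp_mul /single_fun; case: eqP => [e|_]; last by rewrite gmul1.
by case: _ / e.
Qed.

Lemma rprod_countable : (forall i, countable_type (F i)) -> countable_type rprod.
Proof.
move=> Fc.
have Fc' i : exists c : F i -> nat, injective c by exact: Fc.
pose c i := projT1 (cid (Fc' i)).
have cinj i : injective (c i) := projT2 (cid (Fc' i)).
have /choice[m mP] : forall x : rprod, exists m, dp_supp m (sval x) by case.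
exists (fun x => pickle [seq c i (sval x i) | i <- iota 0 (m x)]) => x y /(pcan_inj pickleK) exy.
have mxy : m x = m y by have := congr1 size exy; rewrite !size_map !size_iota.
have e : sval x = sval y.
  apply: functional_extensionality_dep => i; case: (ltnP i (m x)) => [lti|lei]; last first.
    by rewrite (mP x i lei) (mP y i) // -mxy.
  have := congr1 (fun s => nth 0%N s i) exy.
  by rewrite !(nth_map 0%N) ?size_iota -?mxy // nth_iota // => /cinj.
by case: x y e {exy mxy} => [x px] [y py] /= e; exact: eq_exist.
Qed.

End RestrictedProduct.

Fixpoint tower k : group := if k is k'.+1 then sus_group (tower k') else base_group.

Lemma tower_countable k : countable_type (tower k).
Proof. by elim: k => [|k IHk]; [exact: base_countable | exact: sus_countable]. Qed.

(** Level [k] carries a class of degree [k + 2]: the quasimorphism class starts the tower and each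
    suspension adds one. *)
Lemma tower_class k : exists c : seq (tower k) -> R,
  [/\ bcocyc k.+3 c, two_valued_null k.+3 c & ~ bcobd k.+2 c].
Proof.
elim: k => [|k [c [c_coc c2 cN]]].
  exists base_class; split; [exact: base_bcocyc | exact: base_two_valued | exact: base_nontrivial].
exists (sus_class_cocycle c); split; [exact: sus_bcocyc | exact: sus_class_two_valued |].
move=> /(sus_nontrivial (tower_countable k) c_coc); exact: cN.
Qed.

Definition bigB : group := rprod tower.
Definition bigH : group := rprod (fun=> bigB).

Lemma bigB_countable : countable_type bigB.
Proof. exact: rprod_countable tower_countable. Qed.

Lemma bigH_countable : countable_type bigH.
Proof. by apply: rprod_countable => _; exact: bigB_countable. Qed.

Lemma geometric_sum_le2 (t : R) m : 0 <= t <= 2^-1 -> \sum_(i < m) t ^+ i <= 2.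
Proof.
(* Subtracting [2 * 2^-1 ^+ m] strengthens the bound enough for induction. *)
move=> /andP[t0 t2]; suff : \sum_(i < m) t ^+ i <= 2 - 2 * 2^-1 ^+ m.
  by move=> /le_trans; apply; rewrite gerBl mulr_ge0 // exprn_ge0 // invr_ge0.
elim: m => [|m IHm]; first by rewrite big_ord0 expr0; lra.
rewrite big_ord_recr /= exprS.
have : t ^+ m <= 2^-1 ^+ m by rewrite lerXn2r // nnegrE; lra.
move: IHm; set a := \sum_(_ < _) _; set b := 2^-1 ^+ m; lra.
Qed.

(** The Vandermonde argument: apply the moments to the polynomial that vanishes at every parameter
    except that of [r]. *)
Lemma poly_moments_zero (rs : seq R) (d tau : R -> R) : uniq rs -> injective tau ->
  (forall i, \sum_(r <- rs) d r * tau r ^+ i = 0) -> forall r, r \in rs -> d r = 0.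
Proof.
move=> uniq_rs tau_inj mom r r_in.
pose p := \prod_(r' <- rem r rs) ('X - (tau r')%:P).
have : \sum_(r' <- rs) d r' * p.[tau r'] = 0.
  under eq_bigr => r' _ do rewrite horner_coef mulr_sumr.
  rewrite exchange_big big1 //= => i _.
  under eq_bigr => r' _ do rewrite mulrCA.
  by rewrite -mulr_sumr mom mulr0.
rewrite (perm_big _ (perm_to_rem r_in)) big_cons big1_seq => [|r' /= r'_in]; last first.
  have -> : p.[tau r'] = 0; last by rewrite mulr0.
  by rewrite /p (perm_big _ (perm_to_rem r'_in)) big_cons hornerM !hornerE subrr mul0r.
rewrite /= addr0 => /eqP; rewrite mulf_eq0 => /orP[/eqP//|].
rewrite /p horner_prod prodf_seq_eq0 => /hasP[r' r'_in].
rewrite !hornerE subr_eq0 => /eqP/tau_inj e; subst r'.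
by rewrite mem_rem_uniqF in r'_in.
Qed.

Section BigClasses.
Variables (k : nat) (c : seq (tower k) -> R).
Hypotheses (c_coc : bcocyc k.+3 c) (c2 : two_valued_null k.+3 c) (cN : ~ bcobd k.+2 c).
Variables (L : (nat -> R) -> R) (L_lim : generalized_limit L).

Definition coord i (x : bigH) : tower k := proj k (proj i x).

Lemma coord_hom i : is_hom (coord i). Proof. by []. Qed.

Definition partial_class (t : R) m (s : seq bigH) : R := \sum_(i < m) t ^+ i * c (map (coord i) s).

(** The series [sum_i t^i c(x_i)]; the generalized limit keeps the uniform bound on the partial sums
    and the cocycle identity. *)
Definition big_class (t : R) (s : seq bigH) : R := L (fun m => partial_class t m s).

Lemma partial_class_bound : exists M : R, forall t, 0 <= t <= 2^-1 -> forall m s, size s = k.+3 ->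
  `|partial_class t m s| <= M.
Proof.
have [[[M cM] _] _] := c_coc; exists (2 * M) => t t2 m s sz.
have M0 : 0 <= M by apply: le_trans (cM _ (size_nseq k.+3 gone)).
apply: le_trans (ler_norm_sum _ _ _) _.
apply: (@le_trans _ _ (\sum_(i < m) t ^+ i * M)).
  apply: ler_sum => i _; rewrite normrM ger0_norm; last by apply: exprn_ge0; case/andP: t2.
  by apply: ler_wpM2l; [apply: exprn_ge0; case/andP: t2 | apply: cM; rewrite size_map].
by rewrite -mulr_suml ler_wpM2r // geometric_sum_le2.
Qed.

Lemma big_class_bcocyc t : 0 <= t <= 2^-1 -> bcocyc k.+3 (big_class t).
Proof.
move=> t2; have [M pM] := partial_class_bound; have [[_ cinv] c0] := c_coc.
have [_ _ LM _] := L_lim.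
split; [split|].
- by exists M => s sz; apply: LM => m; exact: pM.
- move=> g s sz; congr L; apply/funext => m; apply: eq_bigr => i _; congr (_ * _).
  by rewrite (map_hom (@coord_hom i)) cinv ?size_map.
- move=> s sz; rewrite (ds_glim L_lim (fun m t' => pM t t2 m t') sz).
  apply: (glim_eventually L_lim (N := 0%N)) => m _.
  rewrite /partial_class ds_sum big1 // => i _.
  by rewrite dsZ -ds_map c0 ?size_map // mulr0.
Qed.

Definition inject i (x : tower k) : bigH := @single (fun=> bigB) i (single x).

Lemma inject_hom i : is_hom (inject i).
Proof. by move=> x y; rewrite /inject (@single_hom tower k) (@single_hom (fun=> bigB) i). Qed.

(** In every other copy the arguments are trivial, and [c] vanishes on constant tuples by
    two-valuedness. *)
Lemma big_class_inject t i s : size s = k.+3 -> big_class t (map (inject i) s) = t ^+ i * c s.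
Proof.
move=> sz; apply: (glim_eventually L_lim (N := i.+1)) => m lti.
rewrite /partial_class (bigD1 (Ordinal lti)) //= big1 ?addr0 => [|j ne].
  congr (_ * c _); rewrite -map_comp -[RHS]map_id; apply: eq_map => x /=.
  by rewrite /coord /inject !single_same.
rewrite (c2 (u := gone) (v := gone)) ?size_map ?mulr0 //.
do 2! apply: every_map; elim: (s) => [|x s' IHs] //; split=> //; left.
by rewrite /coord /inject single_other.
Qed.

(** Pulling back along [inject i] turns the combination into its [i]-th moment times [c]. As [c] is
    nontrivial, all moments vanish. *)
Lemma big_class_independent (tau : R -> R) (rs : seq R) (d : R -> R) : uniq rs -> injective tau ->
  bcobd k.+2 (fun s => \sum_(r <- rs) d r * big_class (tau r) s) -> forall r, r \in rs -> d r = 0.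
Proof.
move=> uniq_rs tau_inj triv; apply: (poly_moments_zero uniq_rs tau_inj) => i.
set D := \sum_(r <- rs) _; apply/eqP; apply/negP => /negP D0; apply: cN.
have [h hb hE] := bcobd_map (@inject_hom i) triv.
exists (fun s => D^-1 * h s); first exact: bcochZ.
move=> s sz; rewrite dsZ -hE // -[LHS](mulKf D0); congr (_ * _).
by rewrite mulr_suml; apply: eq_bigr => r _; rewrite big_class_inject // mulrA.
Qed.

End BigClasses.

(** * Coding functions by reals between 0 and one half *)

Section BinaryReal.
Implicit Types b : nat -> bool.

(** In base 4 with digits 0 and 1, all later digits add up to at most a third of the last unit, so
    distinct digit sequences give distinct reals. *)
Definition digits b m : R := \sum_(i < m) (b i)%:R * 4^-1 ^+ i.+1.

Lemma digitsS b m : digits b m.+1 = digits b m + (b m)%:R * 4^-1 ^+ m.+1.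
Proof. by rewrite /digits big_ord_recr. Qed.

Lemma digits_mono b m k : digits b m <= digits b (m + k).
Proof.
elim: k => [|k IHk]; first by rewrite addn0.
by rewrite addnS digitsS; apply: le_trans IHk _; rewrite lerDl mulr_ge0 ?exprn_ge0 // invr_ge0.
Qed.

Lemma digits_tail b m k : digits b (m + k) <= digits b m + 3^-1 * (4^-1 ^+ m - 4^-1 ^+ (m + k)).
Proof.
elim: k => [|k IHk]; first by rewrite addn0 subrr mulr0 addr0.
rewrite addnS digitsS !exprS; set q := _ ^+ (m + k).
have q0 : 0 <= q by rewrite exprn_ge0 // invr_ge0.
move: IHk; rewrite -/q; set p := _ ^+ m; set u := digits b (m + k); set v := digits b m.
by case: (b _) => /=; lra.
Qed.

Definition bool_real b : R := sup [set digits b m | m in [set: nat]]%classic.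

Lemma digits_le b m k : digits b k <= digits b m + 3^-1 * 4^-1 ^+ m.
Proof.
have p0 j : 0 <= (4^-1 : R) ^+ j by rewrite exprn_ge0 // invr_ge0.
case: (leqP m k) => [lemk|/ltnW lekm].
  rewrite -(subnKC lemk); apply: le_trans (digits_tail _ _ _) _.
  by have := p0 (m + (k - m))%N; lra.
by have := digits_mono b k (m - k); rewrite subnKC // => /le_trans; apply; rewrite lerDl mulr_ge0 // invr_ge0.
Qed.

Lemma bool_real_le b m : bool_real b <= digits b m + 3^-1 * 4^-1 ^+ m.
Proof.
apply: ge_sup; first by exists (digits b 0); exists 0%N.
by move=> _ [k _ <-]; exact: digits_le.
Qed.

Lemma bool_real_ge b m : digits b m <= bool_real b.
Proof.
apply: ub_le_sup; last by exists m.
by exists (digits b 0 + 3^-1 * 4^-1 ^+ 0) => _ [k _ <-]; exact: digits_le.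
Qed.

Lemma bool_real_itv b : 0 <= bool_real b <= 2^-1.
Proof.
have := bool_real_ge b 0; have := bool_real_le b 0.
by rewrite /digits big_ord0 expr0; lra.
Qed.

Lemma bool_real_inj : injective bool_real.
Proof.
suff lt b b' i : (forall j, (j < i)%N -> b j = b' j) -> b i -> ~~ b' i -> bool_real b' < bool_real b.
  move=> b b' e; apply/funext => j; apply/eqP; apply/negP => /negP nej.
  have ex : exists j, b j != b' j by exists j.
  case: (ex_minnP ex) => i nei mini.
  have eqlt l : (l < i)%N -> b l = b' l.
    by move=> ltl; apply/eqP; apply: contraTT ltl => /mini; rewrite -leqNgt.
  move: nei; case bi: (b i); case b'i: (b' i) => // _.
    by have := lt b b' i eqlt bi; rewrite b'i e ltxx => /(_ isT).
  have := lt b' b i (fun l ltl => esym (eqlt l ltl)) b'i; rewrite bi e ltxx => /(_ isT) //.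
move=> eqlt bi nb'i.
have := bool_real_ge b i.+1; have := bool_real_le b' i.+1; rewrite !digitsS bi (negbTE nb'i).
have -> : digits b i = digits b' i by apply: eq_bigr => j _; rewrite eqlt.
have : 0 < (4^-1 : R) ^+ i.+1 by rewrite exprn_gt0 // invr_gt0.
by rewrite /= mul1r mul0r; lra.
Qed.

End BinaryReal.

(** A real function on a countable set is determined by countably many bits, the rational lower cuts
    of its values. *)
Lemma cochain_real_inj (X : Type) : countable_type X ->
  exists2 f : (X -> R) -> R, injective f & forall x, 0 <= f x <= 2^-1.
Proof.
move=> [c cinj].
pose cut (f : X -> R) (j : nat) : bool :=
  if unpickle j is Some p then `[< exists x, c x = (p : nat * rat).1 /\ ratr p.2 < f x >] else false.
exists (fun f => bool_real (cut f)) => [f g /bool_real_inj e|f]; last exact: bool_real_itv.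
 apply/funext => x.
have eq_lt (q : rat) : (ratr q < f x) = (ratr q < g x).
  have := congr1 (fun b => b (pickle (c x, q))) e; rewrite /cut pickleK /= => ee.
  have lt (h : X -> R) : (ratr q < h x) = `[< exists y, c y = c x /\ ratr q < h y >].
    by apply/idP/asboolP => [lt|[y [/cinj->]]//]; exists x.
  by rewrite !lt.
apply/eqP; rewrite eq_le !leNgt; apply/andP; split; apply/negP => /rat_in_itvoo[q].
  by rewrite in_itv /= => /andP[lt1 lt2]; move: lt2; rewrite eq_lt ltNge ltW.
by rewrite in_itv /= => /andP[lt1 lt2]; move: lt2; rewrite -eq_lt ltNge ltW.
Qed.

Lemma tuples_countable (X : Type) k : countable_type X -> countable_type ('I_k -> X).
Proof.
move=> [c cinj]; exists (fun x => pickle [seq c (x i) | i <- enum 'I_k]) => x y /(pcan_inj pickleK) e.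
apply/funext => i; apply: cinj.
have nthE (z : 'I_k -> X) : nth 0%N [seq c (z j) | j <- enum 'I_k] i = c (z i).
  by rewrite (nth_map i) ?size_enum_ord ?ltn_ord // nth_ord_enum.
by rewrite -!nthE e.
Qed.

(** * A basis indexed by the continuum *)

Section Dimension.
Variables (H : group) (n : nat).
Hypothesis H_countable : countable_type H.
Notation V := (cochain H n.+1).
Variable b0 : R -> V.
Hypothesis b0_coc : forall r, bcocycle (b0 r).
Hypothesis b0_ind : forall (rs : seq R) (d : R -> R), uniq rs ->
  bcoboundary (lincomb b0 rs d) -> forall r, r \in rs -> d r = 0.

Definition lc (s : seq V) (d : V -> R) : V := fun x => \sum_(v <- s) d v * v x.

Definition independent (J : set V) : Prop := forall (s : seq V) (d : V -> R), uniq s ->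
  (forall v, v \in s -> J v) -> bcoboundary (lc s d) -> forall v, v \in s -> d v = 0.

Lemma bcoboundaryZ (a : R) (z : V) : bcoboundary z -> bcoboundary (fun x => a * z x).
Proof.
move=> [g [[[M gM] ginv] gE]]; exists (fun x => a * g x); split.
  split; last by move=> h x; rewrite ginv.
  by exists (`|a| * M) => x; rewrite normrM ler_wpM2l.
move=> x; rewrite gE /delta mulr_sumr; apply: eq_bigr => i _; ring.
Qed.

Lemma eq_bcoboundary (z z' : V) : (forall x, z x = z' x) -> bcoboundary z -> bcoboundary z'.
Proof. by move=> /funext ->. Qed.

Lemma bcoboundary0 : bcoboundary (fun _ : 'I_n.+2 -> H => 0 : R).
Proof.
exists (fun=> 0); split; first by split=> //; exists 0 => x; rewrite normr0.
by move=> x; rewrite /delta big1 // => i _; rewrite mulr0.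
Qed.

Lemma b0_inj : injective b0.
Proof.
move=> r r' e; apply/eqP; apply/negP => /negP ne.
have := b0_ind (rs := [:: r; r']) (d := fun x => if x == r then 1 else -1).
rewrite /= inE ne => /(_ isT) ind.
have : (fun x => if x == r then 1 else -1 : R) r = 0.
  apply: ind; last by rewrite inE eqxx.
  apply: eq_bcoboundary bcoboundary0 => x.
  by rewrite /lincomb !big_cons big_nil eqxx eq_sym (negbTE ne) e; ring.
by rewrite eqxx => /eqP; rewrite oner_eq0.
Qed.

Lemma lincomb_lc (g : R -> V) (f : V -> R) (s : seq V) d : (forall v, v \in s -> g (f v) = v) ->
  lincomb g (map f s) (fun r => d (g r)) = lc s d.
Proof.
move=> gf; apply/funext => x; rewrite /lincomb /lc big_map big_seq [RHS]big_seq.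
by apply: eq_bigr => v vs; rewrite gf.
Qed.

Lemma range_independent : independent (range b0).
Proof.
move=> s d uniq_s sB bd v vs.
have /choice[f fP] : forall v, exists r, v \in s -> b0 r = v.
  move=> w; case: (boolP (w \in s)) => [/sB[r _ e]|_]; last by exists 0.
  by exists r.
have uniq_fs : uniq (map f s).
  by rewrite map_inj_in_uniq // => u w us ws e; rewrite -(fP u us) -(fP w ws) e.
have := b0_ind (d := fun r => d (b0 r)) uniq_fs.
rewrite (lincomb_lc _ fP) => /(_ bd (f v) (map_f f vs)).
by rewrite fP.
Qed.

Lemma exists_maximal_independent : exists J : set V,
  [/\ (range b0 `<=` J)%classic, forall v, J v -> bcocycle v, independent J &
      forall z, bcocycle z -> ~ J z -> ~ independent (J `|` [set z])%classic].
Proof.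
pose B0 : set V := range b0.
pose P (A : set V) := independent (A `|` B0)%classic /\ (forall v, A v -> bcocycle v).
(* Zorn is applied to the set [A] added to [B0], so that the empty chain is harmless. *)
have [A [[Aind Acoc] Amax]] : exists A, P A /\ forall B, (A `<` B)%classic -> ~ P B.
  apply: Zorn_bigcup => F FP Ftot; split; last by move=> v [X FX Xv]; apply: (FP X FX).2.
  move=> s d uniq_s sub.
  (* A finite family lies in one member of the chain together with [B0]; [set0] serves when it lies
     in [B0] alone. *)
  have [X [XF sX]] : exists X, (F X \/ X = set0) /\ forall v, v \in s -> (X `|` B0)%classic v.
    elim: s {uniq_s} sub => [|w s IHs] sub; first by exists set0; split; [right|].
    have [|X [FX sX]] := IHs; first by move=> v vs; apply: sub; rewrite inE vs orbT.
    have [[Y FY Yw]|Bw] := sub w (mem_head _ _); last first.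
      by exists X; split=> // v; rewrite inE => /predU1P[->|/sX]; [right|].
    have [Z [FZ [XZ YZ]]] : exists Z, F Z /\ (X `<=` Z)%classic /\ (Y `<=` Z)%classic.
      case: FX => [FX|->]; last by exists Y; split=> //; split; [exact: sub0set | exact: subset_refl].
      by have [le|le] := Ftot X Y FX FY; [exists Y | exists X]; split=> //; split=> //; exact: subset_refl.
    exists Z; split; first by left.
    move=> v; rewrite inE => /predU1P[->|/sX[Xv|Bv]]; [by left; exact: YZ | by left; exact: XZ | by right].
  have Xind : independent (X `|` B0)%classic.
    case: XF => [FX|->]; first exact: (FP X FX).1.
    by rewrite set0U; exact: range_independent.
  exact: Xind.
exists (A `|` B0)%classic; split => //.
- by move=> v [/Acoc//|[r _ <-]]; exact: b0_coc.
- move=> z zc nz indz; apply: (Amax (A `|` [set z])%classic).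
    split; first by move=> v Av; left.
    by move=> /(_ z (or_intror erefl)) Az; apply: nz; left.
  split; last by move=> v [/Acoc//|->].
  by rewrite setUAC.
Qed.

Lemma dim_continuum : Hb_dim_continuum H n.
Proof.
have [J [BJ Jcoc Jind Jmax]] := exists_maximal_independent.
(* [J] contains the injective family [b0], and a countable group has at most continuum many
   cochains. *)
have /card_bijP[g [f gK fK]] : ([set: R] #= J)%card.
  apply: Cantor_Bernstein.
    have /injfunPex[i] : exists2 i : R -> V, set_fun setT J i & set_inj setT i.
      exists b0; first by move=> r _; apply: BJ; exists r.
      by move=> r r' _ _; exact: b0_inj.
    exact: inj_card_le.
  have [e e_inj _] := cochain_real_inj (tuples_countable n.+2 H_countable).
  have /injfunPex[i] : exists2 i : V -> R, set_fun J setT i & set_inj J i.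
    by exists e => // v w _ _; exact: e_inj.
  exact: inj_card_le.
pose b r : V := val (g (SigSub (mem_setT r))).
have bJ r : J (b r) by exact/set_mem/valP.
have b_surj v : J v -> exists r, b r = v.
  move=> Jv; exists (val (f (SigSub (mem_set Jv)))).
  rewrite /b; set u := SigSub (mem_setT _); have -> : u = f (SigSub (mem_set Jv)) by exact: val_inj.
  by rewrite fK.
have b_inj : injective b.
  by move=> r r' /val_inj/(can_inj gK)/(congr1 val).
exists b; split; first by move=> r; apply: Jcoc.
split.
  move=> rs d uniq_rs bd r r_in.
  have /choice[h hK] : forall v, exists r, forall r', b r' = v -> r' = r.
    move=> v; have [[r0 e]|ne] := pselect (exists r, b r = v).
      by exists r0 => r'; rewrite -e => /b_inj.
    by exists 0 => r' e; case: ne; exists r'.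
  have hb r' : h (b r') = r' by rewrite -(hK (b r') r').
  have uniq_s : uniq (map b rs) by rewrite map_inj_uniq.
  have := Jind _ (fun v => d (h v)) uniq_s.
  have -> : lc (map b rs) (fun v => d (h v)) = lincomb b rs d.
    by apply/funext => x; rewrite /lc /lincomb big_map; apply: eq_bigr => r' _; rewrite hb.
  move=> /(_ _ bd (b r) (map_f b r_in)); rewrite hb; apply.
  by move=> _ /mapP[r' _ ->].
move=> z zc.
have /choice[h hP] : forall v, exists r, J v -> b r = v.
  by move=> v; have [/b_surj[r e]|nJ] := pselect (J v); [exists r | exists 0 => /nJ].
have [Jz|nJz] := pselect (J z).
  exists [:: h z], (fun=> 1); apply: eq_bcoboundary bcoboundary0 => x.
  by rewrite /lincomb big_cons big_nil hP //; ring.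
(* Maximality yields a dependence involving [z]. The coefficient of [z] is nonzero by independence
   of [J], and dividing by it expresses [z] through [J]. *)
have := Jmax z zc nJz.
move=> /existsNP[s] /existsNP[d] /not_implyP[uniq_s] /not_implyP[sub] /not_implyP[bd].
move=> /existsNP[v] /not_implyP[vs dv].
have sub' w : w \in s -> w != z -> J w by move=> /sub[//|->]; rewrite eqxx.
have zs : z \in s.
  apply/negP => /negP zs; apply: dv; apply: (Jind _ d uniq_s) => // w ws; apply: sub' => //.
  by apply: contraNneq zs => <-.
have lcE x : lc s d x = d z * z x + lc (rem z s) d x.
  by rewrite /lc (perm_big _ (perm_to_rem zs)) big_cons.
have remJ w : w \in rem z s -> J w.
  by rewrite mem_rem_uniq // inE => /andP[ne ws]; exact: sub'.
have dz : d z != 0.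
  apply/negP => /eqP dz0; apply: dv.
  case: (eqVneq v z) => [->//|ne]; apply: (Jind _ d (rem_uniq z uniq_s)) => //.
    by apply: eq_bcoboundary bd => x; rewrite lcE dz0 mul0r add0r.
  by rewrite mem_rem_uniq // inE ne.
exists (map h (rem z s)), (fun r => - (d z)^-1 * d (b r)).
rewrite (lincomb_lc (fun v => - (d z)^-1 * d v)) => [|w /remJ]; last exact: hP.
apply: eq_bcoboundary (bcoboundaryZ (d z)^-1 bd) => x.
rewrite lcE mulrDr mulKf // /lc mulr_sumr -sumrN; congr (_ + _).
by apply: eq_bigr => w _; ring.
Qed.

End Dimension.

(** * The extension *)

Lemma bigH_dim k : Hb_dim_continuum bigH k.+1.
Proof.
have [c [c_coc c2 cN]] := tower_class k.
have [L L_lim] := exists_generalized_limit.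
have unit_countable : countable_type unit by exists (fun=> 0%N) => -[] [].
(* On a one-point set the coding injects the reals into the admissible parameters. *)
have [f f_inj f_itv] := cochain_real_inj unit_countable.
pose tau (r : R) : R := f (fun=> r).
have tau_inj : injective tau by move=> r r' /f_inj/(congr1 (fun g => g tt)).
pose b (r : R) : cochain bigH k.+2 := ofseq (big_class c L (tau r)).
apply: (dim_continuum bigH_countable (b0 := b)) => [r|rs d uniq_rs bd].
  have [Cb C0] := big_class_bcocyc c_coc L_lim (f_itv (fun=> r)).
  have e s : size s = k.+3 -> big_class c L (tau r) s = toseq (b r) s by move=> sz; rewrite ofseqK.
  apply/bcocycP; split; first exact: eq_bcoch Cb.
  by move=> s sz; rewrite -(C0 s sz); apply: (eq_ds sz) => u su; rewrite e.
apply: (big_class_independent c2 cN L_lim (d := d) uniq_rs tau_inj).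
move/bcobdP: bd; apply: eq_bcobd => s sz; apply: eq_bigr => r _.
by rewrite -(ofseqK _ sz).
Qed.

(** With trivial letters [lamp] becomes the finitary symmetric group, which is the quotient. *)
Definition unit_group : group :=
  @Defs.Group unit (fun _ _ => tt) (fun _ => tt) tt (fun _ _ _ => erefl) (fun x => match x with tt => erefl end) (fun _ => erefl).

Section Extension.
Variable B : group.

Lemma base_incl_supp (h : rprod (fun=> B)) : exists m, wr_supp m (Wr (fun i => proj i h) (bone nat)).
Proof. by case: h => h [m sh]; exists m => i /sh. Qed.

Definition base_incl (h : rprod (fun=> B)) : lamp B := exist _ _ (base_incl_supp h).

Lemma lamp_perm_supp (x : lamp B) : exists m, wr_supp m (Wr (fun=> (tt : unit_group)) (wperm (sval x))).
Proof. by case: x => x [m sx]; exists m => i /sx[]. Qed.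

Definition lamp_perm (x : lamp B) : lamp unit_group := exist _ _ (lamp_perm_supp x).

Lemma base_incl_hom : is_hom base_incl.
Proof. by move=> x y; apply: eq_exist; apply: wr_ext. Qed.

Lemma base_incl_inj : injective base_incl.
Proof.
move=> x y /(congr1 (fun z : lamp B => wfun (sval z))) /= e.
have : sval x = sval y by apply: functional_extensionality_dep => i; exact: (congr1 (fun g => g i) e).
by case: x y {e} => [x px] [y py] /= e; exact: eq_exist.
Qed.

Lemma lamp_perm_hom : is_hom lamp_perm.
Proof. by move=> x y; apply: eq_exist; apply: wr_ext. Qed.

Lemma lamp_perm_surj q : exists x, lamp_perm x = q.
Proof.
have sx : exists m, wr_supp m (Wr (fun=> (gone : B)) (wperm (sval q))).
  by case: q => q [m sq]; exists m => i /sq[].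
exists (exist (fun x : wreath B => exists m, wr_supp m x) _ sx); apply: lamp_ext; apply: wr_ext => i //=.
by case: (wfun _ _).
Qed.

Lemma lamp_perm_kernel x : lamp_perm x = gone <-> exists h, base_incl h = x.
Proof.
split=> [/(congr1 (fun z : lamp unit_group => wperm (sval z))) /= e|[h <-]]; last exact: lamp_ext.
have sh : exists m, @dp_supp (fun=> B) m (wfun (sval x)) by case: x {e} => x [m sx]; exists m => i /sx[].
exists (exist (fun h : dprod (fun=> B) => exists m, dp_supp m h) _ sh).
by apply: lamp_ext; apply: wr_ext => i //=; rewrite e.
Qed.

End Extension.

(* 1 -> H --i--> Gamma --p--> Q -> 1 exact: H is a normal subgroup of Gamma
   and Q = Gamma/H. *)
Theorem theorem4p5 :
  exists (Gamma H Q : group) (i : H -> Gamma) (p : Gamma -> Q),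
    is_hom i /\ injective i /\ is_hom p /\
    (forall q : Q, exists g, p g = q) /\
    (forall g : Gamma, p g = gone <-> exists h, i h = g) /\
    boundedly_acyclic Gamma /\ boundedly_acyclic Q /\
    (forall n : nat, (1 <= n)%N -> Hb_dim_continuum H n).
Proof.
exists (lamp bigB), bigH, (lamp unit_group), (@base_incl bigB), (@lamp_perm bigB).
split; first exact: base_incl_hom.
split; first exact: base_incl_inj.
split; first exact: lamp_perm_hom.
split; first exact: lamp_perm_surj.
split; first exact: lamp_perm_kernel.
split; first exact: lamp_acyclic bigB_countable.
split; first by apply: lamp_acyclic; exists (fun=> 0%N) => -[] [].
(* The index is one less than the degree, so index [k + 1] is served by level [k] of the tower. *)
by case=> // k _; exact: bigH_dim.
Qed.
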